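(* Let $d\ge1$ and $C_{pDG^+}\ge1$. There exists a constant $C\ge1$, depending only on $d$ and $C_{pDG^+}$, such that for every parabolic cylinder $Q\subset\mathbb{R}\times\mathbb{R}^d$, every $S\in L^\infty(Q)$, every $u\in\mathrm{pDG}^+(Q,S)$ (with constant $C_{pDG^+}$), every $Q_R(X_0)\subset Q$ and every $r\in(0,R)$, $$\|u_+\|_{L^\infty(Q_r(X_0))}\le C\left(\Big(1+\frac1{r^2}+\frac1{(R-r)^2}\Big)^{\omega_0}\|u_+\|_{L^2(Q_R(X_0))}+\|S\|_{L^\infty(Q_R(X_0))}\right)$$ with $\omega_0=\frac{(d+4)(d+2)}{8}$.
   Context: For $X_0=(t_0,x_0)\in\mathbb{R}\times\mathbb{R}^d$ and $R>0$, the parabolic cylinder is $Q_R(X_0)=(t_0-R^2,t_0]\times B_R(x_0)$, where $B_R(x_0)$ is the open Euclidean ball; $a_+=\max(a,0)$. Parabolic De Giorgi class: let $I=(a,b]$ and $B$ be an open ball of $\mathbb{R}^d$. $u:I\times B\to\mathbb{R}$ lies in $\mathrm{pDG}^+(I\times B,S)$ with constant $C_{pDG^+}\ge1$ if $u\in L^\infty(I,L^2(B))$, $\nabla_xu\in L^2(I\times B)$ and, for all $X_0=(t_0,x_0)\in I\times B$, all $0<r<R$ with $Q_R(X_0)\subset I\times B$, and all $\kappa\in\mathbb{R}$, $$\sup_{t\in(t_0-r^2,t_0]}\int_{B_r(x_0)}(u-\kappa)_+^2dx+\int_{Q_r(X_0)}|\nabla_x(u-\kappa)_+|^2dt\,dx\le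 C_{pDG^+}\Big(\frac1{(R-r)^2}+\frac1{r^2}\Big)\int_{Q_R(X_0)}(u-\kappa)_+^2dt\,dx+C_{pDG^+}\int_{Q_R(X_0)}|S|(u-\kappa)_+dt\,dx.$$ *)

(* Defs.v *)
From HB Require Import structures.
From mathcomp Require Import all_boot all_order all_algebra.
From mathcomp Require Import all_classical all_reals all_analysis.
From mathcomp Require Import ess_sup_inf.

Set Implicit Arguments.
Unset Strict Implicit.
Unset Printing Implicit Defensive.

Import Order.TTheory GRing.Theory Num.Theory.
Import numFieldNormedType.Exports.

Local Open Scope classical_set_scope.
Local Open Scope ring_scope.

(* Row vectors carry the sigma-algebra generated by the coordinates; over the
   reals this is the Borel sigma-algebra. *)
Definition rV_display : measure_display -> measure_display.
Proof. exact. Qed.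

Section measurable_rV.
Context {d} {T : sigmaRingType d}.
Variable n : nat.

Let coors : 'I_n -> 'rV[T]_n -> T := fun i x => x ord0 i.

Let rV_set0 : g_sigma_preimage coors set0.
Proof. exact: sigma_algebra0. Qed.

Let rV_setC A : g_sigma_preimage coors A -> g_sigma_preimage coors (~` A).
Proof. exact: sigma_algebraC. Qed.

Let rV_bigcup (F : _^nat) : (forall i, g_sigma_preimage coors (F i)) ->
  g_sigma_preimage coors (\bigcup_i (F i)).
Proof. exact: sigma_algebra_bigcup. Qed.

HB.instance Definition _ := @isMeasurable.Build (rV_display d)
  'rV[T]_n (g_sigma_preimage coors) rV_set0 rV_setC rV_bigcup.

End measurable_rV.

Lemma measurable_coord d (T : sigmaRingType d) n (i : 'I_n) :
  measurable_fun [set: 'rV[T]_n] (fun x : 'rV[T]_n => x ord0 i).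
Proof.
move=> _ Y mY; rewrite setTI; apply: sub_sigma_algebra => /=.
rewrite -bigcup_seq/=; exists i => /=; first by rewrite mem_index_enum.
by exists Y => //; rewrite setTI.
Qed.

Lemma measurable_fun_coordP d1 d2 (T1 : measurableType d1)
    (T2 : measurableType d2) n (f : T1 -> 'rV[T2]_n) :
  (forall i, measurable_fun [set: T1] (fun x => f x ord0 i)) ->
  measurable_fun [set: T1] f.
Proof.
move=> mf.
have fG : preimage_set_system [set: T1] f (@measurable _ 'rV[T2]_n)
    `<=` measurable.
  rewrite -(@g_sigma_preimage_comp _ _ _ 'rV[T2]_n
    (fun i (x : 'rV[T2]_n) => x ord0 i)).
  apply: smallest_sub; first exact: sigma_algebra_measurable.
  rewrite -bigcup_seq; apply: bigcup_sub => i _ A [B mB <-].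
  exact: mf.
by move=> _ A mA; apply: fG; exists A.
Qed.

Section lebesgue_rV_step.
Context {R : realType} {n : nat}.

Definition cons_rV (z : measurableTypeR R * 'rV[R]_n) : 'rV[R]_n.+1 :=
  row_mx (const_mx z.1 : 'rV[R]_1) z.2.

Definition uncons_rV (x : 'rV[R]_n.+1) : measurableTypeR R * 'rV[R]_n :=
  (lsubmx (x : 'rV[R]_(1 + n)) ord0 ord0, rsubmx (x : 'rV[R]_(1 + n))).

Lemma cons_rVK : cancel cons_rV uncons_rV.
Proof.
by move=> [t x]; rewrite /uncons_rV /cons_rV row_mxKl row_mxKr mxE.
Qed.

Lemma measurable_cons_rV : measurable_fun setT cons_rV.
Proof.
apply: measurable_fun_coordP => i.
rewrite (_ : (fun _ => _) = fun z : measurableTypeR R * 'rV[R]_n =>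
    match @fintype.split 1 n (i : 'I_(1 + n)) with inl _ => z.1 | inr j => z.2 ord0 j end).
  case: (fintype.split _) => j; first exact: measurable_fst.
  apply: (measurableT_comp (measurable_coord j)); exact: measurable_snd.
by apply/funext => z; rewrite /cons_rV mxE; case: (fintype.split _) => j; rewrite ?mxE.
Qed.

Lemma measurable_uncons_rV : measurable_fun setT uncons_rV.
Proof.
apply/measurable_fun_pairP; split.
  rewrite (_ : _ \o _ = fun x : 'rV[R]_n.+1 => x ord0 (@lshift 1 n ord0)).
    exact: measurable_coord.
  by apply/funext => x /=; rewrite mxE.
apply: measurable_fun_coordP => i.
rewrite (_ : (fun _ => _) = fun x : 'rV[R]_n.+1 => x ord0 (@rshift 1 n i)).
  exact: measurable_coord.
by apply/funext => x /=; rewrite mxE.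
Qed.

Variable mu : {sigma_finite_measure set 'rV[R]_n -> \bar R}.

Definition lebesgue_step : set 'rV[R]_n.+1 -> \bar R :=
  pushforward (lebesgue_measure \x mu)%E cons_rV.

HB.instance Definition _ := Measure.copy lebesgue_step
  (measure_function_pushforward__canonical__measure_function_Measure
    (lebesgue_measure \x mu)%E measurable_cons_rV).

Let lebesgue_step_sigma_finite : sigma_finite setT lebesgue_step.
Proof.
have /sigma_finiteP[F [TF ndF Foo]] := sigma_finiteT (@lebesgue_measure R).
have /sigma_finiteP[G [TG ndG Goo]] := sigma_finiteT mu.
exists (fun k => uncons_rV @^-1` (F k `*` G k)).
  rewrite -preimage_bigcup (_ : \bigcup_k _ = setT) ?preimage_setT//.
  apply/seteqP; split => // -[t x] _.
  have [m _ Fm] : (\bigcup_k F k) t by rewrite -TF.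
  have [k _ Gk] : (\bigcup_k G k) x by rewrite -TG.
  exists (maxn m k) => //; split.
    by move: t Fm; exact/subsetPset/ndF/leq_maxl.
  by move: x Gk; exact/subsetPset/ndG/leq_maxr.
move=> k; have [mF Fk] := Foo k; have [mG Gk] := Goo k; split.
  rewrite -[X in measurable X]setTI; apply: measurable_uncons_rV => //.
  exact: measurableX.
rewrite /lebesgue_step /pushforward -comp_preimage.
rewrite (_ : uncons_rV \o cons_rV = id) ?preimage_id; last first.
  by apply/funext => z; exact: cons_rVK.
by rewrite product_measure1E// lte_mul_pinfty// ge0_fin_numE.
Qed.

HB.instance Definition _ := Measure_isSigmaFinite.Build _ _ _ lebesgue_step
  lebesgue_step_sigma_finite.

End lebesgue_rV_step.

(* Lebesgue measure on R^n: the image of the n-fold product of the Lebesgue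
   measure on R, see [lebesgue_rV_box]. *)
Fixpoint lebesgue_rV (R : realType) (n : nat) :
    {sigma_finite_measure set 'rV[R]_n -> \bar R} :=
  match n with
  | 0 => dirac (0 : 'rV[R]_0)
  | n'.+1 => lebesgue_step (lebesgue_rV R n')
  end.

Lemma lebesgue_rV_box (R : realType) (n : nat) (A : 'I_n -> set R) :
  (forall i, measurable (A i)) ->
  lebesgue_rV R n [set x | forall i, A i (x ord0 i)] =
  (\prod_(i < n) lebesgue_measure (A i))%E.
Proof.
elim: n A => [|n IH] A mA.
  rewrite big_ord0 /= diracE mem_set//; by case.
have mB : measurable [set x : 'rV[R]_n | forall i, A (lift ord0 i) (x ord0 i)].
  rewrite [X in measurable X](_ : _ = \big[setI/setT]_(i < n)
      ((fun x : 'rV[R]_n => x ord0 i) @^-1` A (lift ord0 i))).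
    apply: bigsetI_measurable => i _; rewrite -[X in measurable X]setTI.
    exact: measurable_coord.
  rewrite -bigcap_seq; apply/seteqP; split => [x Ax i _|x Ax i]; first exact: Ax.
  by apply: (Ax i); rewrite /= mem_index_enum.
rewrite big_ord_recl -(IH (fun i => A (lift ord0 i)))//=.
have mA0 : measurable (A ord0 : set (measurableTypeR R)) by exact: mA.
transitivity ((lebesgue_measure \x lebesgue_rV R n)%E
    ((A ord0 : set (measurableTypeR R)) `*`
     [set x : 'rV[R]_n | forall i, A (lift ord0 i) (x ord0 i)])); last first.
  by rewrite product_measure1E.
rewrite /lebesgue_step /pushforward.
congr ((_ \x _)%E _); apply/seteqP; split => -[t x] /=.
  move=> Atx; split; first by have := Atx ord0; rewrite /cons_rV mxE;
    case: fintype.splitP => // j _; rewrite mxE.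
  move=> i; have := Atx (lift ord0 i); rewrite /cons_rV mxE.
  case: (@fintype.splitP 1 n (lift ord0 i)) => j ij; first by case: j ij => -[].
  by rewrite (_ : j = i)//; apply: val_inj; case: ij.
move=> [At Ax] i; rewrite /cons_rV mxE.
case: (@fintype.splitP 1 n i) => j ij; rewrite ?mxE.
  by rewrite (_ : i = ord0)//; apply: val_inj; rewrite /= ij ord1.
by rewrite (_ : i = lift ord0 j)//; apply: val_inj.
Qed.

Section parabolic.
Context {R : realType} {d : nat}.

(* [measurableTypeR R] is [R] with the Borel sigma-algebra on which
   [lebesgue_measure] is defined. *)
Local Notation spacetime := (measurableTypeR R * 'rV[R]_d)%type.

Definition lebesgue_tx : set spacetime -> \bar R :=
  (lebesgue_measure \x lebesgue_rV R d)%E.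

HB.instance Definition _ := Measure.on lebesgue_tx.

(* The norm of the normed module ['rV[R]_d] is the sup norm. *)
Definition enorm (x : 'rV[R]_d) : R := Num.sqrt (\sum_i x ord0 i ^+ 2).

Definition eball (x0 : 'rV[R]_d) (r : R) : set 'rV[R]_d :=
  [set x | enorm (x - x0) < r].

Definition cylinder (a b : R) (y : 'rV[R]_d) (l : R) : set spacetime :=
  `]a, b] `*` eball y l.

(* The parabolic cylinder (t0 - r^2, t0] x B_r(x0) with X0 = (t0, x0). *)
Definition pcyl (X0 : spacetime) (r : R) : set spacetime :=
  cylinder (X0.1 - r ^+ 2) X0.1 X0.2 r.

(* [f \_ D] is [f] extended by 0 outside of [D]. *)
Definition Lnorm_on (D : set spacetime) (p : \bar R) (f : spacetime -> R)
    : \bar R :=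
  'N[lebesgue_tx]_p [EFin \o (f \_ D)].

Definition in_Lp (D : set spacetime) (p : \bar R) (f : spacetime -> R) : Prop :=
  measurable_fun D f /\ (Lnorm_on D p f < +oo)%E.

Definition pos_part (f : spacetime -> R) : spacetime -> R :=
  fun z => Num.max (f z) 0.

(* Since [v] is arbitrary, this is existence and continuity of all partial
   derivatives, in time and space, up to order [k]. *)
Fixpoint Ck (k : nat) (f : R * 'rV[R]_d -> R) : Prop :=
  continuous f /\
  match k with
  | 0 => True
  | k'.+1 => forall v, (forall z, derivable f z v) /\ Ck k' ('D_v f)
  end.

Definition test_function (U : set (R * 'rV[R]_d)) (phi : R * 'rV[R]_d -> R) :=
  [/\ forall k, Ck k phi, compact (closure [set z | phi z != 0]) &
      closure [set z | phi z != 0] `<=` U].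

Definition loc_integrable (U : set (R * 'rV[R]_d)) (f : spacetime -> R) :=
  forall K : set (R * 'rV[R]_d), compact K -> K `<=` U ->
    lebesgue_tx.-integrable K (EFin \o f).

(* [g] is the distributional spatial gradient of [f] on the interior of [D].
   For D = (a, b] x B the interior is (a, b) x B, which misses only a
   Lebesgue-null time slice. *)
Definition weak_gradx (D : set spacetime) (f : spacetime -> R)
    (g : spacetime -> 'rV[R]_d) : Prop :=
  let U := interior (D : set (R * 'rV[R]_d)) in
  [/\ loc_integrable U f,
      forall i, measurable_fun D (fun z => g z ord0 i),
      forall i, loc_integrable U (fun z => g z ord0 i) &
      forall phi, test_function U phi -> forall i : 'I_d,
        \int[lebesgue_tx]_(z in D) (f z * 'D_(0, delta_mx ord0 i) phi z) =
        - \int[lebesgue_tx]_(z in D) (g z ord0 i * phi z)].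

Local Open Scope ereal_scope.

(* The class pDG+((a, b] x B_l(y), S) with constant [C].  Members of
   L^oo((a, b], L^2(B)) are defined up to a.e. equality, so the supremum in t is
   the essential supremum; all functions under [ess_sup] are nonnegative, hence
   extending them by 0 outside of the time interval is harmless.  The functions
   [g] and [h] are the weak gradients of [u] and of [w] = (u - kappa)_+, unique
   almost everywhere. *)
Definition pDG (C a b : R) (y : 'rV[R]_d) (l : R) (S u : spacetime -> R) :
    Prop :=
  let Q := cylinder a b y l in
  [/\ measurable_fun Q u,
      ess_sup lebesgue_measure
        ((fun t => \int[lebesgue_rV R d]_(x in eball y l) (u (t, x) ^+ 2)%:E)
           \_ `]a, b]) < +oo,
      exists2 g, weak_gradx Q u g &
        \int[lebesgue_tx]_(z in Q) (enorm (g z) ^+ 2)%:E < +oo &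
      forall kappa : R,
        let w := pos_part (fun z => u z - kappa)%R in
        exists2 h, weak_gradx Q w h &
          forall (X0 : spacetime) (r rho : R), Q X0 ->
            (0 < r < rho)%R -> pcyl X0 rho `<=` Q ->
            ess_sup lebesgue_measure
              ((fun t => \int[lebesgue_rV R d]_(x in eball X0.2 r)
                           (w (t, x) ^+ 2)%:E)
                 \_ `](X0.1 - r ^+ 2)%R, X0.1])
            + \int[lebesgue_tx]_(z in pcyl X0 r) (enorm (h z) ^+ 2)%:E
            <= (C * (((rho - r) ^+ 2)^-1 + (r ^+ 2)^-1))%:E
                 * \int[lebesgue_tx]_(z in pcyl X0 rho) (w z ^+ 2)%:E
               + C%:E * \int[lebesgue_tx]_(z in pcyl X0 rho)
                          (`|S z| * w z)%:E].

End parabolic.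

(* Main.v *)
Require Import Defs.
From HB Require Import structures.
From mathcomp Require Import all_boot all_order all_algebra.
From mathcomp Require Import all_classical all_reals all_analysis.
From mathcomp Require Import measurable_realfun ess_sup_inf.
From mathcomp Require Import ring lra.

(** The proof is De Giorgi's iteration over levels and radii. Let A be the
integral of (u - k)_+^2 over a cylinder, k' > k a higher level and
w = (u - k')_+. The energy inequality controls, on a smaller cylinder, the
slice integrals of w^2 at almost all times and the integral of |grad w|^2 by a
number E proportional to A; the source term is absorbed because
w <= (u - k)_+^2 / (k' - k) and because the gaps k' - k used are at least the
bound of |S| times a geometric factor. By Chebyshev's inequality the set {w > 0} has
measure at most M = A / (k' - k)^2.

The gain of integrability does not come from a Sobolev embedding but from a
Nash type inequality, whose proof only uses translations. For every vector v,
  w(z)^2 <= (w(z + v) - w(z))^2 + 2 w(z) w(z + v).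
Averaging over v in a cube of side eta, the first term is at most
(d eta)^2 times the integral of |grad w|^2, and the second one is at most
2 eta^-d times the integral over t of (\int w(t, x) dx)^2, hence at most
2 eta^-d E M by the Cauchy-Schwarz inequality on each slice ([nash]). As
translations shorter than the gap between the radii stay inside the larger
cylinder, no cut-off function is needed. This gives the recursion
[de_giorgi_step]
  A' <= (d eta)^2 E + 2 eta^-d E M.
With L = 1 + r^-2 + (rho - r)^-2 and eta of order 2^-n / sqrt L at step n, it
propagates the bound A_n <= alpha 2^(-n (d + 4)) as soon as the final level
kappa satisfies kappa^2 >= K sqrt(L)^(d + 2) alpha ([de_giorgi_iteration]).
Hence the natural exponent of L in the estimate is (d + 2) / 4, which is at most
omega0, and L >= 1.

What the weak gradient has to provide is the identity
  w(z + v) - w(z) = \int_0^1 v . grad w(z + s v) ds   for almost every z.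
Against a smooth test function it follows from the definition, the fundamental
theorem of calculus along the segment and Fubini's theorem ([weak_shift]). Two
integrable functions with the same integrals against test functions agree
almost everywhere ([ae_eq_of_smooth]): the sets {p > 0} with p smooth are stable
under finite intersections, generate the sigma-algebra, and their indicators
are limits of test functions. *)

Set Implicit Arguments.
Unset Strict Implicit.
Unset Printing Implicit Defensive.

Import Order.TTheory GRing.Theory Num.Theory.
Import numFieldNormedType.Exports.

Local Open Scope classical_set_scope.
Local Open Scope ring_scope.

(** * Translation invariance of the Lebesgue measures *)

Section translation.
Context {R : realType}.

Lemma measurable_shiftR (a : R) :
  measurable_fun setT ((fun x => x + a) : measurableTypeR R -> measurableTypeR R).
Proof. exact: measurable_funD. Qed.

Lemma lebesgue_measure_shift (a : R) (A : set (measurableTypeR R)) :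
  measurable A ->
  lebesgue_measure ((fun x : R => x + a) @^-1` A) = lebesgue_measure A.
Proof.
move=> mA; apply/esym.
pose mu := measure_function_pushforward__canonical__measure_function_Measure
  (@lebesgue_measure R) (measurable_shiftR a).
apply: (@lebesgue_measure_unique R mu) => // _ [[x y] _ <-] /=.
rewrite /pushforward.
rewrite (_ : _ @^-1` _ = `]x - a, y - a]%classic); last first.
  by apply/seteqP; split => z /=; rewrite !in_itv/= ltrBlDr lerBrDr.
rewrite !lebesgue_measure_itv/= !lte_fin ltrD2r; case: ifPn => // _.
by rewrite -!EFinD; congr (_%:E); ring.
Qed.

Lemma measurable_shift_rV n (v : 'rV[R]_n) :
  measurable_fun setT (fun x : 'rV[R]_n => x + v).
Proof.
apply: measurable_fun_coordP => i.
rewrite (_ : (fun _ => _) = fun x : 'rV[R]_n => x ord0 i + v ord0 i); last first.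
  by apply/funext => x; rewrite mxE.
by apply: measurable_funD => //; exact: measurable_coord.
Qed.

(** The measure is defined by recursion on the dimension, so the translation is
split into its first coordinate and the others; uniqueness of product measures
reduces the claim to rectangles. *)
Lemma lebesgue_rV_shift n (v : 'rV[R]_n) (A : set 'rV[R]_n) : measurable A ->
  lebesgue_rV R n ((fun x => x + v) @^-1` A) = lebesgue_rV R n A.
Proof.
elim: n v A => [|n IH] v A mA.
  by congr (lebesgue_rV R 0 _); apply/seteqP; split => x /=; rewrite !thinmx0.
rewrite /= /lebesgue_step /pushforward.
set a := v ord0 ord0.
pose v' : 'rV[R]_n := \row_i v ord0 (rshift 1 i).
pose sh (z : measurableTypeR R * 'rV[R]_n) : measurableTypeR R * 'rV[R]_n :=
  (z.1 + a, z.2 + v').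
have msh : measurable_fun setT sh.
  apply/measurable_fun_pairP; split => /=.
    apply: (measurableT_comp (measurable_shiftR a)); exact: measurable_fst.
  apply: (measurableT_comp (measurable_shift_rV v')); exact: measurable_snd.
pose mu := measure_function_pushforward__canonical__measure_function_Measure
  (lebesgue_measure \x lebesgue_rV R n)%E msh.
have mcA : measurable (cons_rV @^-1` A).
  by rewrite -[X in measurable X]setTI; exact: measurable_cons_rV.
rewrite -[LHS]/((lebesgue_measure \x lebesgue_rV R n)%E (cons_rV @^-1` [set x | A (x + v)])).
rewrite (@product_measure_unique _ _ _ _ _ _ _ mu _ (cons_rV @^-1` A) mcA) /=.
  rewrite /pushforward; congr ((_ \x _)%E _).
  apply/seteqP; split => -[t x] /=; congr (A _); apply/rowP => i;
    rewrite /cons_rV /sh !mxE; case: splitP => j ij; rewrite !mxE//;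
    congr (_ + v ord0 _); apply: val_inj => //=; by rewrite ij// ord1.
move=> B C mB mC; rewrite /pushforward.
rewrite (_ : sh @^-1` _ =
    ((fun x : R => x + a) @^-1` B) `*` ((fun x => x + v') @^-1` C))//.
have mB' : measurable ((fun x : measurableTypeR R => x + a) @^-1` B).
  by rewrite -[X in measurable X]setTI; exact: measurable_shiftR.
have mC' : measurable ((fun x => x + v') @^-1` C).
  by rewrite -[X in measurable X]setTI; exact: measurable_shift_rV.
rewrite product_measure1E// IH//; congr (_ * _)%E.
exact: lebesgue_measure_shift.
Qed.

End translation.

Section measure_preserving.
Local Open Scope ereal_scope.
Context d (T : measurableType d) (R : realType) (mu : {measure set T -> \bar R}).
Variable tau : T -> T.
Hypothesis mtau : measurable_fun setT tau.
Hypothesis mutau : forall A, measurable A -> mu (tau @^-1` A) = mu A.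

Lemma ge0_integral_measure_preserving (f : T -> \bar R) :
  measurable_fun setT f -> (forall x, 0 <= f x) ->
  \int[mu]_x f (tau x) = \int[mu]_x f x.
Proof.
move=> mf f0.
rewrite -[LHS]/(\int[mu]_(x in tau @^-1` setT) (f \o tau) x).
rewrite -(@ge0_integral_pushforward _ _ _ _ _ _ mtau)//.
by apply: eq_measure_integral => A mA _; exact: mutau.
Qed.

Lemma integrable_measure_preserving (f : T -> \bar R) :
  mu.-integrable setT f -> mu.-integrable setT (f \o tau).
Proof.
move=> /integrableP[mf foo]; apply/integrableP; split.
  exact: measurableT_comp mf mtau.
by rewrite (ge0_integral_measure_preserving (f := abse \o f))//=;
  exact: measurableT_comp.
Qed.

Lemma integral_measure_preserving (f : T -> \bar R) :
  mu.-integrable setT f ->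
  \int[mu]_x f (tau x) = \int[mu]_x f x.
Proof.
move=> fi; have mf := measurable_int _ fi.
rewrite integralE [RHS]integralE.
rewrite -(ge0_integral_measure_preserving (f := f^\+))//;
  last exact: measurable_funepos.
rewrite -(ge0_integral_measure_preserving (f := f^\-))//;
  last exact: measurable_funeneg.
congr (_ - _); apply: eq_integral => x _.
  by rewrite -[RHS]/((f^\+ \o tau) x) -funepos_comp.
by rewrite -[RHS]/((f^\- \o tau) x) -funeneg_comp.
Qed.

End measure_preserving.

(** * Euclidean norm, balls and cylinders *)

Section euclidean_norm.
Context {R : realType} {d : nat}.
Implicit Types x y : 'rV[R]_d.

Definition dot x y : R := \sum_i x ord0 i * y ord0 i.

Lemma enorm_ge0 x : 0 <= enorm x. Proof. exact: sqrtr_ge0. Qed.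

Lemma enorm_sqr x : enorm x ^+ 2 = \sum_i x ord0 i ^+ 2.
Proof. by rewrite sqr_sqrtr// sumr_ge0// => i _; exact: sqr_ge0. Qed.

Lemma dot_sqr_le x y : dot x y ^+ 2 <= enorm x ^+ 2 * enorm y ^+ 2.
Proof.
rewrite !enorm_sqr; set A := \sum_i _; set B := \sum_i _; set C := dot x y.
have B0 : 0 <= B by rewrite sumr_ge0// => i _; exact: sqr_ge0.
have : 0 <= \sum_i (B * x ord0 i - C * y ord0 i) ^+ 2.
  by rewrite sumr_ge0// => i _; exact: sqr_ge0.
rewrite (eq_bigr (fun i => B ^+ 2 * x ord0 i ^+ 2
  - (B * C *+ 2) * (x ord0 i * y ord0 i) + C ^+ 2 * y ord0 i ^+ 2)); last first.
  by move=> i _; ring.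
rewrite big_split/= sumrB -!mulr_sumr -/A -/B -/(dot x y) -/C.
have [B00|B00] := eqVneq B 0.
  move=> _; rewrite B00 mulr0.
  have y0 i : y ord0 i = 0.
    apply/eqP; rewrite -sqrf_eq0; move/eqP: B00.
    by rewrite psumr_eq0 => [/allP/(_ i)/=->//|j _]; rewrite ?mem_index_enum ?sqr_ge0.
  by rewrite /C /dot big1 ?expr0n// => i _; rewrite y0 mulr0.
have Bgt0 : 0 < B by rewrite lt0r B00.
rewrite (_ : _ + _ = B * (A * B - C ^+ 2)); last by ring.
by rewrite pmulr_rge0// subr_ge0.
Qed.

Lemma ler_enormD x y : enorm (x + y) <= enorm x + enorm y.
Proof.
rewrite -(@ler_pXn2r _ 2)// ?nnegrE ?addr_ge0 ?enorm_ge0//.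
rewrite enorm_sqr (_ : \sum_i _ = enorm x ^+ 2 + dot x y *+ 2 + enorm y ^+ 2).
  rewrite sqrrD lerD2r lerD2l lerMn2r/=.
  rewrite (le_trans (ler_norm _))// -(@ler_pXn2r _ 2)// ?nnegrE ?mulr_ge0 ?enorm_ge0//.
  by rewrite real_normK ?num_real// exprMn dot_sqr_le.
rewrite !enorm_sqr /dot -sumrMnl -!big_split/=; apply: eq_bigr => i _.
by rewrite mxE sqrrD.
Qed.

Lemma enormZ (a : R) x : 0 <= a -> enorm (a *: x) = a * enorm x.
Proof.
move=> a0; rewrite /enorm; under eq_bigr do rewrite mxE exprMn.
by rewrite -mulr_sumr sqrtrM ?sqr_ge0// sqrtr_sqr ger0_norm.
Qed.

Lemma coord_le_enorm x i : `|x ord0 i| <= enorm x.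
Proof.
rewrite -(@ler_pXn2r _ 2)// ?nnegrE ?enorm_ge0//.
rewrite real_normK ?num_real// enorm_sqr (bigD1 i)//= lerDl.
by rewrite sumr_ge0// => j _; exact: sqr_ge0.
Qed.

Lemma eballD (x0 x v : 'rV[R]_d) (r r' : R) : enorm v <= r' - r ->
  eball x0 r x -> eball x0 r' (x + v).
Proof.
rewrite /eball/= => vr xr; rewrite addrAC.
by rewrite (le_lt_trans (ler_enormD _ _))//; lra.
Qed.

Lemma measurable_enorm : measurable_fun setT (@enorm R d).
Proof.
apply: (measurableT_comp (f := @Num.sqrt R)).
  apply: continuous_measurable_fun; exact: sqrt_continuous.
apply: measurable_sum => i; apply: measurable_funX; exact: measurable_coord.
Qed.

Lemma measurable_eball x0 (r : R) : measurable (eball x0 r).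
Proof.
rewrite (_ : eball x0 r = (fun x => enorm (x - x0)) @^-1` `]-oo, r[%classic); last first.
  by apply/seteqP; split => x; rewrite /eball/= in_itv.
rewrite -[X in measurable X]setTI.
apply: (measurableT_comp measurable_enorm (measurable_shift_rV (- x0))) => //.
Qed.

Lemma lebesgue_rV_eball_lty x0 (r : R) : (lebesgue_rV R d (eball x0 r) < +oo)%E.
Proof.
pose A (i : 'I_d) : set R := `](x0 ord0 i - r), (x0 ord0 i + r)[%classic.
have mA : measurable [set x : 'rV[R]_d | forall i, A i (x ord0 i)].
  rewrite [X in measurable X](_ : _ = \bigcap_(i in [set: 'I_d])
      ((fun x : 'rV[R]_d => x ord0 i) @^-1` A i)); last first.
    by apply/seteqP; split => x /= h i => [_|]; exact: h.
  apply: fin_bigcap_measurable => // i _; rewrite -[X in measurable X]setTI.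
  by apply: measurable_coord => //; exact: measurable_itv.
apply: (@le_lt_trans _ _ (lebesgue_rV R d [set x | forall i, A i (x ord0 i)])).
  apply: le_measure; rewrite ?inE//; first exact: measurable_eball.
  move=> x /= xr i; rewrite /A /= in_itv/=.
  have := le_lt_trans (coord_le_enorm (x - x0) i) xr.
  by rewrite !mxE ltr_norml; lra.
rewrite lebesgue_rV_box; last by move=> i; exact: measurable_itv.
have -> : (\prod_(i < d) lebesgue_measure (A i) =
    (\prod_(i < d) Num.max (r + r) 0)%:E)%E; last exact: ltry.
rewrite -prodEFin; apply: eq_bigr => i _.
rewrite [LHS]lebesgue_measure_itv/= lte_fin; case: ltP => h.
  by rewrite -EFinD; congr EFin; rewrite max_l; lra.
by rewrite max_r//; lra.
Qed.

End euclidean_norm.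

Section spacetime.
Context {R : realType} {d : nat}.
Local Notation spacetime := (measurableTypeR R * 'rV[R]_d)%type.
Local Notation tx := (@lebesgue_tx R d).

Let tx_sigma_finite : sigma_finite setT tx.
Proof.
have /sigma_finiteP[F [TF ndF Foo]] := sigma_finiteT (@lebesgue_measure R).
have /sigma_finiteP[G [TG ndG Goo]] := sigma_finiteT (lebesgue_rV R d).
exists (fun k => F k `*` G k).
  apply/seteqP; split => // -[t x] _.
  have [m _ Fm] : (\bigcup_k F k) t by rewrite -TF.
  have [k _ Gk] : (\bigcup_k G k) x by rewrite -TG.
  exists (maxn m k) => //; split.
    by move: t Fm; exact/subsetPset/ndF/leq_maxl.
  by move: x Gk; exact/subsetPset/ndG/leq_maxr.
move=> k; have [mF Fk] := Foo k; have [mG Gk] := Goo k; split.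
  exact: measurableX.
by rewrite [X in (X < _)%E]product_measure1E// lte_mul_pinfty// ge0_fin_numE.
Qed.

HB.instance Definition _ := Measure_isSigmaFinite.Build _ _ _ tx tx_sigma_finite.

Definition xshift (v : 'rV[R]_d) (z : spacetime) : spacetime := (z.1, z.2 + v).

Lemma measurable_xshift v : measurable_fun setT (xshift v).
Proof.
apply/measurable_fun_pairP; split; first exact: measurable_fst.
apply: (measurableT_comp (measurable_shift_rV v)); exact: measurable_snd.
Qed.

Lemma lebesgue_tx_xshift v A : measurable A -> tx (xshift v @^-1` A) = tx A.
Proof.
move=> mA; apply/esym.
pose mu := measure_function_pushforward__canonical__measure_function_Measure
  tx (measurable_xshift v).
apply: (@product_measure_unique _ _ _ _ _ _ _ mu) => // B C mB mC.
rewrite /= /pushforward.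
rewrite (_ : xshift v @^-1` _ = B `*` ((fun x => x + v) @^-1` C))//.
have mC' : measurable ((fun x => x + v) @^-1` C).
  by rewrite -[X in measurable X]setTI; exact: measurable_shift_rV.
rewrite [LHS]product_measure1E//; congr (_ * _)%E; exact: lebesgue_rV_shift.
Qed.

Lemma measurable_cylinder a b (y : 'rV[R]_d) l : measurable (cylinder a b y l).
Proof. by apply: measurableX => //; exact: measurable_eball. Qed.

Lemma cylinder_lty a b (y : 'rV[R]_d) l : (tx (cylinder a b y l) < +oo)%E.
Proof.
rewrite [X in (X < _)%E]product_measure1E//; last exact: measurable_eball.
have ab : (lebesgue_measure (`]a, b]%classic : set R) < +oo)%E.
  by rewrite lebesgue_measure_itv/=; case: ifP => // _; rewrite -EFinD ltry.
by rewrite lte_mul_pinfty ?lebesgue_rV_eball_lty// ge0_fin_numE.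
Qed.

End spacetime.

(** * A class of smooth functions *)

Section flat.
Context {R : realType}.
Implicit Types (P : {poly R}) (x : R).

(** The functions P(1/x) exp(-1/x), extended by zero to x <= 0. Unlike the single
function exp(-1/x), the family is stable under differentiation ([dflat] gives the
new polynomial), so that one induction yields derivatives of all orders. *)
Definition flat P x : R := if 0 < x then P.[x^-1] * expR (- x^-1) else 0.

Definition dflat P : {poly R} := 'X^2 * (P - P^`()).

Lemma flat_le0 P x : x <= 0 -> flat P x = 0.
Proof. by rewrite /flat ltNge => ->. Qed.

Lemma flat_gt0 P x : 0 < x -> flat P x = P.[x^-1] * expR (- x^-1).
Proof. by rewrite /flat => ->. Qed.

(** Since exp y dominates every power of y = 1/x, [flat P] vanishes at 0; the
linear rate, applied to ['X * P], is what differentiability at 0 requires. *)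
Lemma flat_le_linear P : exists K : R, forall x, 0 < x <= 1 -> `|flat P x| <= K * x.
Proof.
exists (\sum_(i < size P) `|P`_i| * ((size P).+1)`!%:R) => x /andP[x0 x1].
rewrite flat_gt0// horner_coef mulr_suml mulr_suml.
apply: (le_trans (ler_norm_sum _ _ _)); apply: ler_sum => i _.
rewrite -mulrA normrM -mulrA ler_wpM2l ?normr_ge0//.
rewrite ger0_norm ?mulr_ge0 ?exprn_ge0 ?invr_ge0 ?expR_ge0 ?(ltW x0)//.
rewrite expRN ler_pdivrMr ?expR_gt0//.
set y := x^-1; have y0 : 0 < y by rewrite invr_gt0.
have y1 : 1 <= y by rewrite invf_ge1.
have := expR_ge1Dxn (size P) (ltW y0); set n := size P => h.
apply: (@le_trans _ _ ((n.+1)`!%:R * x * (y ^+ n.+1 / (n.+1)`!%:R))); last first.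
  rewrite ler_wpM2l// ?mulr_ge0// ?(ltW x0)//.
  by apply: le_trans h; rewrite lerDr.
rewrite [leRHS](_ : _ = y ^+ n * (x * y)); last first.
  have f0 : n.+1`!%:R != 0 :> R by rewrite pnatr_eq0 -lt0n fact_gt0.
  rewrite exprS; move: (n.+1`!%:R) f0 => F f0.
  by field.
rewrite /y mulfV ?gt_eqF// mulr1 -/y; apply: ler_weXn2l => //.
by rewrite ltnW.
Qed.

Lemma is_derive_flat P x : is_derive x (1 : R) (flat P) (flat (dflat P) x).
Proof.
have [x0|x0|->] := ltgtP x 0.
- rewrite [flat (dflat P) x]flat_le0 ?(ltW x0)//.
  apply: (@near_eq_is_derive _ _ _ (cst 0)).
  near=> y; rewrite flat_le0//; near: y; exact: lt_le_nbhsl.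
- rewrite flat_gt0//.
  have x00 : x != 0 by rewrite gt_eqF.
  have dV : is_derive x (1 : R) (fun y : R => y^-1) (- x ^- 2 *: 1).
    exact: is_deriveV.
  have dNV : is_derive x (1 : R) (fun y : R => - y^-1) (- (- x ^- 2 *: 1)).
    exact: is_deriveN.
  have D : is_derive x (1 : R)
      ((horner P \o (fun y => y^-1)) * (expR \o (fun y => - y^-1)))
      ((dflat P).[x^-1] * expR (- x^-1)).
    apply: is_derive_eq; rewrite /dflat /= !hornerE /=.
    rewrite /GRing.scale/=; move: (expR _) => e.
    by field.
  refine (near_eq_is_derive _ D).
  by near=> y; rewrite flat_gt0//; near: y; exact: lt_nbhsr.
- rewrite flat_le0//; have [K PK] := flat_le_linear ('X * P).
  have cv : (fun h : R => h^-1 *: ((flat P \o shift 0) (h *: 1) - flat P 0)) @ 0^' --> (0 : R).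
    apply/cvgr0Pnorm_lt => e e0; near=> h.
    rewrite /= [flat P 0]flat_le0// subr0 addr0 [h *: 1]mulr1.
    have [h0|h0] := lerP h 0; first by rewrite flat_le0// scaler0 normr0.
    rewrite (_ : _ *: _ = flat ('X * P) h); last first.
      by rewrite /GRing.scale/= !flat_gt0// hornerM hornerX mulrA.
    have h1 : h <= 1.
      by near: h; apply: cvg_within; exact: lt_le_nbhsl.
    have hK : h < e / (`|K| + 1).
      near: h; apply: cvg_within; apply: lt_nbhsl.
      by rewrite divr_gt0// ltr_wpDl.
    have K1 : 0 < `|K| + 1 by rewrite ltr_wpDl.
    rewrite (le_lt_trans (PK _ _)) ?h0//.
    rewrite ltr_pdivlMr// in hK; apply: le_lt_trans hK.
    rewrite mulrC ler_wpM2l ?(ltW h0)//.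
    by rewrite (le_trans (ler_norm _))// lerDl.
  apply: DeriveDef; first by apply/cvg_ex; exists 0.
  exact: cvg_lim cv.
Unshelve. all: by end_near. Qed.

End flat.

Section bump.
Context {R : realType}.

Definition bump (x : R) : R := flat 1 x.

Lemma bump_gt0 x : (0 < bump x) = (0 < x).
Proof.
rewrite /bump; case: (ltP 0 x) => x0; first by rewrite flat_gt0// hornerC mul1r expR_gt0.
by rewrite flat_le0// ltxx.
Qed.

Lemma bump_ge0 x : 0 <= bump x.
Proof.
rewrite /bump; case: (ltP 0 x) => x0; last by rewrite flat_le0.
by rewrite flat_gt0// hornerC mul1r expR_ge0.
Qed.

Lemma bump_le1 x : bump x <= 1.
Proof.
rewrite /bump; case: (ltP 0 x) => x0; last by rewrite flat_le0.
by rewrite flat_gt0// hornerC mul1r expR_le1 oppr_le0 invr_ge0 ltW.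
Qed.

Lemma bump_eq0 x : x <= 0 -> bump x = 0. Proof. exact: flat_le0. Qed.

Lemma continuous_flat P : continuous (@flat R P).
Proof.
move=> x; apply: differentiable_continuous; apply/derivable1_diffP.
by have [] := is_derive_flat P x.
Qed.

Lemma measurable_flat P : measurable_fun setT (@flat R P).
Proof. apply: continuous_measurable_fun; exact: continuous_flat. Qed.

(** The shift by 1 makes the approximations of the indicator of {p > 0} vanish
where p < 1/n, hence compactly supported when the sets {p >= e} are compact. *)
Lemma cvg_bump (p : R) : 0 < p -> bump (n%:R * p - 1) @[n --> \oo] --> (1 : R).
Proof.
move=> p0; rewrite -[X in _ --> X](@expR0 R).
have cvy : (n%:R * p - 1) @[n --> \oo] --> +oo.
  apply/cvgryPge => A; near=> n.
  rewrite lerBrDr -ler_pdivrMr//; near: n; exact: nbhs_infty_ger.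
have cv0 : (- (n%:R * p - 1)^-1) @[n --> \oo] --> (0 : R).
  rewrite -oppr0; apply: cvgN; apply/gtr0_cvgV0 => //.
  by have /cvgryPgt := cvy; apply.
have h := cvg_comp _ _ cv0 (@continuous_expR R 0).
apply: cvg_trans h.
apply: near_eq_cvg; near=> n.
rewrite /= /bump flat_gt0 ?hornerC ?mul1r//.
by near: n; have /cvgryPgt := cvy; apply.
Unshelve. all: by end_near. Qed.

End bump.

Section smooth.
Context {R : realType} {d : nat}.
Local Notation spacetime := (R * 'rV[R]_d)%type.
Local Notation mspacetime := (measurableTypeR R * 'rV[R]_d)%type.

(** A syntactic class rather than the C^oo functions: membership gives, by
induction, measurability for the product sigma-algebra as well as smoothness,
and the class is stable under directional derivatives and translations. It
contains cut-offs of all sets defined by finitely many polynomial inequalities. *)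
Inductive smooth : (spacetime -> R) -> Prop :=
| smooth_cst c : smooth (fun _ => c)
| smooth_time : smooth (fun z => z.1)
| smooth_coord i : smooth (fun z => z.2 ord0 i)
| smoothD p q : smooth p -> smooth q -> smooth (fun z => p z + q z)
| smoothM p q : smooth p -> smooth q -> smooth (fun z => p z * q z)
| smooth_flat P p : smooth p -> smooth (fun z => flat P (p z)).

Let fst_lin : linear (fst : spacetime -> R). Proof. by []. Qed.

Let diff_fst (z : spacetime) :
  differentiable (fst : spacetime -> R) z /\ 'd (fst : spacetime -> R) z = fst :> (_ -> _).
Proof.
pose m := GRing.isLinear.Build _ _ _ _ _ fst_lin.
pose f : {linear spacetime -> R} := HB.pack (fst : spacetime -> R) m.
have cf : continuous f by move=> x; exact: cvg_fst.
split; first exact: (@linear_differentiable _ _ _ f).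
by have := @diff_lin _ _ _ f z cf.
Qed.

Let diff_coord i (z : spacetime) :
  differentiable (fun z : spacetime => z.2 ord0 i) z /\
  'd (fun z : spacetime => z.2 ord0 i) z = (fun z => z.2 ord0 i) :> (_ -> _).
Proof.
have lin : linear (fun z : spacetime => z.2 ord0 i).
  by move=> a x y /=; rewrite !mxE.
pose m := GRing.isLinear.Build _ _ _ _ _ lin.
pose f : {linear spacetime -> R} := HB.pack (fun z : spacetime => z.2 ord0 i) m.
have cf : continuous f.
  move=> x; apply: (@continuous_comp _ _ _ snd (fun y : 'rV[R]_d => y ord0 i)).
    exact: cvg_snd.
  exact: coord_continuous.
split; first exact: (@linear_differentiable _ _ _ f).
by have := @diff_lin _ _ _ f z cf.
Qed.

Let differentiable_flat P x : differentiable (@flat R P) x.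
Proof. by apply/derivable1_diffP; have [] := is_derive_flat P x. Qed.

Lemma smooth_differentiable p : smooth p -> forall z, differentiable p z.
Proof.
elim=> {p} [c|||p q _ hp _ hq|p q _ hp _ hq|P p _ hp] z.
- exact: differentiable_cst.
- by have [] := diff_fst z.
- by move=> z'; have [] := diff_coord z z'.
- exact: differentiableD.
- exact: differentiableM.
- exact: differentiable_comp.
Qed.

Lemma smooth_continuous p : smooth p -> continuous p.
Proof. by move=> sp z; apply/differentiable_continuous/smooth_differentiable. Qed.

Lemma smooth_derive p v : smooth p -> smooth ('D_v p).
Proof.
elim=> {p} [c||i|p q sp hp sq hq|p q sp hp sq hq|P p sp hp].
- rewrite (_ : 'D_v _ = fun=> 0); first exact: smooth_cst.
  by apply/funext => z; exact: derive_cst.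
- rewrite (_ : 'D_v _ = fun=> v.1); first exact: smooth_cst.
  by apply/funext => z; have [df e] := diff_fst z; rewrite deriveE// e.
- rewrite (_ : 'D_v _ = fun=> v.2 ord0 i); first exact: smooth_cst.
  by apply/funext => z; have [df e] := diff_coord i z; rewrite deriveE// e.
- rewrite (_ : 'D_v _ = fun z => 'D_v p z + 'D_v q z); first exact: smoothD.
  apply/funext => z; apply: deriveD; apply: diff_derivable;
    exact: smooth_differentiable.
- rewrite (_ : 'D_v _ = fun z => p z * 'D_v q z + q z * 'D_v p z).
    by apply: smoothD; exact: smoothM.
  apply/funext => z; apply: deriveM; apply: diff_derivable;
    exact: smooth_differentiable.
- rewrite (_ : 'D_v _ = fun z => flat (dflat P) (p z) * 'D_v p z).
    by apply: smoothM => //; exact: smooth_flat.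
  apply/funext => z; have dp := smooth_differentiable sp z.
  rewrite deriveE; last exact: differentiable_comp.
  have -> : 'd (fun z => flat P (p z)) z = 'd (flat P) (p z) \o 'd p z :> (_ -> _).
    exact: diff_comp.
  have [df e] := is_derive_flat P (p z).
  rewrite /= deriv1E// derive1E e [LHS]mulrC; congr (_ * _).
  by rewrite deriveE.
Qed.

Lemma smooth_Ck k p : smooth p -> Ck k p.
Proof.
elim: k p => [|k IH] p sp; first by split => //; exact: smooth_continuous.
split; first exact: smooth_continuous.
move=> v; split; last by apply/IH/smooth_derive.
by move=> z; apply/diff_derivable/smooth_differentiable.
Qed.

Lemma measurable_smooth p : smooth p -> measurable_fun setT (p : mspacetime -> R).
Proof.
elim=> {p} [c||i|p q sp hp sq hq|p q sp hp sq hq|P p sp hp].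
- exact: measurable_cst.
- exact: measurable_fst.
- apply: (measurableT_comp (measurable_coord i)); exact: measurable_snd.
- exact: measurable_funD.
- exact: measurable_funM.
- apply: (measurableT_comp (measurable_flat P)) => //.
Qed.

Lemma smooth_sum (I : eqType) (s : seq I) (p : I -> spacetime -> R) :
  (forall i, smooth (p i)) -> smooth (fun z => \sum_(i <- s) p i z).
Proof.
move=> sp; elim: s => [|i s IH].
  rewrite (_ : (fun _ => _) = fun=> 0); first exact: smooth_cst.
  by apply/funext => z; rewrite big_nil.
rewrite (_ : (fun _ => _) = fun z => p i z + \sum_(j <- s) p j z).
  exact: smoothD.
by apply/funext => z; rewrite big_cons.
Qed.

Lemma smooth_xshift p (v : 'rV[R]_d) : smooth p ->
  smooth (fun z => p (z.1, z.2 + v)).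
Proof.
elim=> {p} [c||i|p q sp hp sq hq|p q sp hp sq hq|P p sp hp] /=.
- exact: smooth_cst.
- exact: smooth_time.
- rewrite (_ : (fun _ => _) = fun z : spacetime => z.2 ord0 i + v ord0 i).
    by apply: smoothD; [exact: smooth_coord|exact: smooth_cst].
  by apply/funext => z; rewrite mxE.
- exact: smoothD.
- exact: smoothM.
- exact: smooth_flat.
Qed.

Lemma smooth_open p : smooth p -> open [set z | 0 < p z].
Proof.
move=> sp; rewrite (_ : [set z | _] = p @^-1` `]0, +oo[%classic).
  by apply: open_comp => // z _; exact: smooth_continuous.
by apply/seteqP; split => z /=; rewrite in_itv/= andbT.
Qed.

Lemma smooth_derive_dir p v z : smooth p ->
  'D_(0, v) p z = \sum_i v ord0 i * 'D_(0, delta_mx ord0 i) p z.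
Proof.
move=> sp; have dp := smooth_differentiable sp z.
rewrite deriveE//.
have -> : (0, v) = \sum_i v ord0 i *: ((0, delta_mx ord0 i) : spacetime).
  rewrite [in LHS](row_sum_delta v).
  apply/eqP; rewrite -pair_eqE /=; apply/andP; split; apply/eqP.
    by rewrite raddf_sum big1// => i _ /=; rewrite scaler0.
  by rewrite [RHS]raddf_sum.
rewrite linear_sum; apply: eq_bigr => i _.
by rewrite linearZ deriveE.
Qed.

End smooth.

(** * The fundamental lemma of the calculus of variations *)

Section fundamental_lemma.
Context {R : realType} {d : nat}.
Local Notation spacetime := (measurableTypeR R * 'rV[R]_d)%type.
Local Notation tx := (@lebesgue_tx R d).
Implicit Types p o : R * 'rV[R]_d -> R.

Definition superlevel : set (set spacetime) :=
  [set [set z | 0 < p z] | p in @smooth R d].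

(** {p > 0} and {q > 0} meet in {bump p * bump q > 0}; the bumps are needed because
the product p q is also positive where both factors are negative. *)
Lemma superlevel_setI_closed : setI_closed superlevel.
Proof.
move=> _ _ [p sp <-] [q sq <-].
exists (fun z => bump (p z) * bump (q z)).
  by apply: smoothM; exact: smooth_flat.
apply/seteqP; split => z /=.
  move=> pq0; split; rewrite -bump_gt0 lt0r bump_ge0 andbT;
    by apply: contraTN pq0 => /eqP ->; rewrite ?(mul0r, mulr0) ltxx.
by move=> [p0 q0]; rewrite mulr_gt0// bump_gt0.
Qed.

(** It suffices that the time and space coordinates be measurable for the generated
sigma-algebra, and their open rays are superlevel sets of smooth functions. *)
Lemma superlevel_generates : (@measurable _ spacetime) `<=` <<s superlevel >>.
Proof.
pose gT := g_sigma_algebraType superlevel.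
suff mid : measurable_fun setT (idfun : gT -> spacetime).
  by move=> A mA; have := mid measurableT A mA; rewrite setTI.
have mray (f : R * 'rV[R]_d -> R) : smooth f ->
    measurable_fun setT (f : gT -> measurableTypeR R).
  move=> sf; apply: (measurability (@RGenOInfty.G R)).
    exact: RGenOInfty.measurableE.
  move=> _ [_ [c ->] <-]; rewrite setTI; apply: sub_sigma_algebra.
  exists (fun z => f z + (- c)).
    by apply: smoothD => //; exact: smooth_cst.
  by apply/seteqP; split => z /=; rewrite in_itv/= andbT subr_gt0.
apply/measurable_fun_pairP; split.
  by apply: (mray (fun z => z.1)); exact: smooth_time.
apply: measurable_fun_coordP => i.
by apply: (mray (fun z => z.2 ord0 i)); exact: smooth_coord.
Qed.

Local Open Scope ereal_scope.

(** The products of bumps of n o - 1 and n p - 1 are admissible test functions and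
converge boundedly to the indicator of {o > 0} intersected with {p > 0}, so the
two integrals agree on these sets; Dynkin's theorem extends this to all
measurable subsets of {o > 0}. *)
Lemma ae_eq_of_smooth o (G1 G2 : spacetime -> \bar R) : smooth o ->
  tx.-integrable setT G1 -> tx.-integrable setT G2 ->
  (forall phi e, smooth phi -> (0 < e)%R ->
    (forall z, phi z != 0%R -> (e <= o z)%R) ->
    \int[tx]_z (G1 z * (phi z)%:E) = \int[tx]_z (G2 z * (phi z)%:E)) ->
  ae_eq tx [set z | (0 < o z)%R] G1 G2.
Proof.
move=> so i1 i2 G12; set O := [set z | _].
have mlev p : smooth p -> measurable ([set z | (0 < p z)%R] : set spacetime).
  move=> sp; rewrite (_ : [set z | _] = p @^-1` `]0%R, +oo[%classic); last first.
    by apply/seteqP; split => z /=; rewrite in_itv/= andbT.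
  by rewrite -[X in measurable X]setTI; apply: (measurable_smooth sp) => //.
have mO : measurable O by exact: mlev.
have lev A : superlevel A -> \int[tx]_(z in O `&` A) G1 z = \int[tx]_(z in O `&` A) G2 z.
  move=> [p sp <-]; set A' := [set z | (0 < p z)%R].
  have mA' : measurable A' by exact: mlev.
  pose phi n z := (bump (n%:R * o z - 1) * bump (n%:R * p z - 1))%R.
  have sphi n : smooth (phi n).
    by apply: smoothM; apply: smooth_flat; apply: smoothD;
      [apply: smoothM => //; exact: smooth_cst|exact: smooth_cst|
       apply: smoothM => //; exact: smooth_cst|exact: smooth_cst].
  have cphi z : phi n z @[n --> \oo] --> (\1_(O `&` A') z : R).
    rewrite indicI /=.
    have c1 q : bump (n%:R * q z - 1)%R @[n --> \oo] --> (\1_[set z | (0 < q z)%R] z : R).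
      rewrite indicE; case: (ltP 0 (q z))%R => q0.
        by rewrite mem_set//; exact: cvg_bump.
      rewrite memNset/=; last by apply/negP; rewrite -leNgt.
      rewrite (_ : (fun _ => _) = cst 0%R); first exact: cvg_cst.
      apply/funext => n; rewrite bump_eq0// lerBlDr add0r.
      by rewrite (le_trans _ (@ler01 R))// mulr_ge0_le0.
    exact: cvgM.
  have phi1 n z : (`|phi n z| <= 1)%R.
    rewrite normrM !ger0_norm ?bump_ge0//.
    by rewrite mulr_ile1 ?bump_ge0 ?bump_le1.
  have lim G : tx.-integrable setT G ->
      \int[tx]_z (G z * (phi n z)%:E) @[n --> \oo] --> \int[tx]_(z in O `&` A') G z.
    move=> iG; rewrite [X in _ --> X]integral_mkcond.
    have mG := measurable_int _ iG.
    have [|||||_ _] := @dominated_convergence _ spacetime R tx setT measurableT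
      (fun n z => G z * (phi n z)%:E) (G \_ (O `&` A')) (abse \o G); last exact.
    - move=> n; apply: emeasurable_funM => //.
      by apply/measurable_EFinP; exact: (measurable_smooth (sphi n)).
    - have mOA : measurable (O `&` A') by exact: measurableI.
      by apply/(measurable_restrictT _ mOA); exact: measurable_funTS.
    - have := integrable_ae measurableT iG; apply: filterS => z /(_ I) Gz _.
      rewrite -(fineK Gz).
      rewrite (_ : (G \_ _) z = (fine (G z) * \1_(O `&` A') z)%:E); last first.
        rewrite patchE indicE; case: ifPn => _; last by rewrite mulr0.
        by rewrite mulr1 fineK.
      apply: cvg_EFin; first by near=> n.
      rewrite (_ : _ \o _ = fun n => fine (G z) * phi n z)%R; last first.
        by apply/funext => n /=.
      by apply: cvgM; [exact: cvg_cst|exact: cphi].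
    - exact: integrable_abse.
    - apply: aeW => z n _; rewrite abseM/= -[leRHS]mule1.
      by rewrite lee_wpmul2l//= lee_fin.
  have := lim _ i1.
  rewrite (_ : (fun _ => _) = fun n => \int[tx]_z (G2 z * (phi n z)%:E)).
    by move=> h1; exact: (cvg_unique _ h1 (lim _ i2)).
  apply/funext => n; case: n => [|n].
    by apply: eq_integral => z _; rewrite /phi bump_eq0 ?mul0r ?mule0// lerBlDr mul0r add0r.
  apply: (G12 _ n.+1%:R^-1%R) => // z; apply: contraR; rewrite -ltNge => oe.
  rewrite /phi bump_eq0 ?mul0r// lerBlDr add0r.
  by rewrite -ler_pdivlMl// mulr1 ltW.
pose H : set (set spacetime) := [set A | measurable A /\
  \int[tx]_(z in O `&` A) G1 z = \int[tx]_(z in O `&` A) G2 z].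
(* complements in the Dynkin class are handled by additivity *)
have split_compl G A : tx.-integrable setT G -> measurable A ->
    \int[tx]_(z in O `&` ~` A) G z = \int[tx]_(z in O) G z - \int[tx]_(z in O `&` A) G z.
  move=> iG mA; have mOA : measurable (O `&` A) by exact: measurableI.
  have mOC : measurable (O `&` ~` A) by apply: measurableI => //; exact: measurableC.
  have fin : \int[tx]_(z in O `&` A) G z \is a fin_num.
    by apply: integrable_fin_num => //; exact: integrableS iG.
  rewrite -[in X in _ = X - _](setIT O) -(setUv A) setIUr integral_setU//.
  - by rewrite addeAC subee// add0e.
  - by apply: measurable_funTS; exact: measurable_int iG.
  - by rewrite disj_set2E; apply/eqP/seteqP; split => // z [[_ ?] [_]].
have OT : superlevel [set: spacetime].
  exists (fun=> 1%R); first exact: smooth_cst.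
  by apply/seteqP; split => z //= _; exact: ltr01.
have HD : dynkin H.
  split.
  - by split => //; exact: lev.
  - move=> A [mA eA]; split; first exact: measurableC.
    rewrite !split_compl// eA; congr (_ - _).
    by have := lev _ OT; rewrite setIT.
  - move=> F tF HF; have mF k : measurable (F k) by have [] := HF k.
    split; first exact: bigcupT_measurable.
    have mOF k : measurable (O `&` F k) by apply: measurableI; [exact: mO|exact: mF].
    have tOF : trivIset setT (fun k => O `&` F k) by first [exact: trivIset_setIl|exact: trivIset_setIr].
    have mU : measurable (\bigcup_k (O `&` F k)) by exact: bigcupT_measurable.
    rewrite setI_bigcupr !integral_bigcup//; [|exact: integrableS i2|exact: integrableS i1].
    by apply: eq_eseriesr => k _; have [] := HF k.
have HA A : measurable A -> H A.
  move=> /superlevel_generates.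
  rewrite -(setI_closed_g_dynkin_g_sigma_algebra superlevel_setI_closed).
  apply: smallest_sub => // _ [p sp <-]; split; first exact: mlev.
  by apply: lev; exists p.
apply: integral_ae_eq => //.
- exact: integrableS i1.
- by apply: measurable_funTS; exact: measurable_int i2.
- move=> E EO mE; have [_] := HA _ mE.
  by rewrite setIidr.
Unshelve. all: by end_near. Qed.

End fundamental_lemma.

(** * Compactly supported test functions *)

Section compact_support.
Context {R : realType} {d : nat}.
Local Notation spacetime := (R * 'rV[R]_d)%type.
Implicit Types (phi : spacetime -> R) (K : set spacetime).

Definition supported K phi := forall z, ~ K z -> phi z = 0.

Lemma supported_derive K phi v : compact K -> supported K phi ->
  supported K ('D_v phi).
Proof.
move=> cK sK z nKz; have clK : closed K by apply: compact_closed.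
rewrite (@near_eq_derive _ _ _ phi (cst 0)); first by rewrite derive_cst.
have : nbhs z (~` K) by apply: open_nbhs_nbhs; split => //; exact: closed_openC.
by apply: filterS => y nKy; exact: sK.
Qed.

Lemma smooth_bounded K phi : smooth phi -> compact K -> supported K phi ->
  exists M, forall z, `|phi z| <= M.
Proof.
move=> sphi cK sK.
have /compact_bounded[M [_ MP]] : compact (phi @` K).
  apply: continuous_compact => //; apply: continuous_subspaceT.
  exact: smooth_continuous.
exists (`|M| + 1) => z; have [Kz|nKz] := pselect (K z).
  apply: MP; last by exists z.
  by rewrite (le_lt_trans (ler_norm _))// ltrDl.
by rewrite sK// normr0 addr_ge0.
Qed.

Lemma test_function_smooth K U phi : smooth phi -> compact K ->
  supported K phi -> K `<=` U -> test_function U phi.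
Proof.
move=> sphi cK sK KU; have clK : closed K by apply: compact_closed.
have sub : closure [set z | phi z != 0] `<=` K.
  rewrite [X in _ `<=` X](closure_id K).1//; apply: closureS => z /=.
  by apply: contraNP => /sK ->.
split; first by move=> k; exact: smooth_Ck.
  exact: (@subclosed_compact _ _ K (@closed_closure _ _) cK sub).
exact: subset_trans KU.
Qed.

End compact_support.

Section cylinder_bump.
Context {R : realType} {d : nat}.
Local Notation spacetime := (R * 'rV[R]_d)%type.
Variables (t1 t2 : R) (x0 : 'rV[R]_d) (r : R).

(** [cylinder] without its final time slice, which is an open set. *)
Definition ocyl : set spacetime :=
  [set z | (t1 < z.1 < t2) && (enorm (z.2 - x0) < r)].

(** The square of the norm is used since the norm is not smooth at the centre. *)
Definition cyl_bump (z : spacetime) : R :=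
  bump (z.1 - t1) * bump (t2 - z.1) * bump (r ^+ 2 - enorm (z.2 - x0) ^+ 2).

Lemma smooth_enorm2 : smooth (fun z : spacetime => enorm (z.2 - x0) ^+ 2).
Proof.
rewrite (_ : (fun _ => _) = fun z : spacetime => \sum_i
    (z.2 ord0 i + (- x0 ord0 i)) * (z.2 ord0 i + (- x0 ord0 i))); last first.
  by apply/funext => z; rewrite enorm_sqr; apply: eq_bigr => i _; rewrite !mxE expr2.
apply: smooth_sum => i; apply: smoothM; apply: smoothD;
  by [exact: smooth_coord|exact: smooth_cst].
Qed.

Lemma smooth_cyl_bump : smooth cyl_bump.
Proof.
apply: smoothM; first apply: smoothM; apply: smooth_flat.
- apply: smoothD; [exact: smooth_time|exact: smooth_cst].
- rewrite (_ : (fun _ => _) = fun z : spacetime => t2 + (-1) * z.1).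
    apply: smoothD; first exact: smooth_cst.
    by apply: smoothM; [exact: smooth_cst|exact: smooth_time].
  by apply/funext => z; rewrite mulN1r.
- rewrite (_ : (fun _ => _) = fun z : spacetime =>
      r ^+ 2 + (-1) * enorm (z.2 - x0) ^+ 2).
    apply: smoothD; first exact: smooth_cst.
    by apply: smoothM; [exact: smooth_cst|exact: smooth_enorm2].
  by apply/funext => z; rewrite mulN1r.
Qed.

Hypothesis r0 : 0 < r.

Lemma cyl_bumpE : [set z | 0 < cyl_bump z] = ocyl.
Proof.
have B0 (a b : R) : 0 <= a -> 0 <= b -> (0 < a * b) = (0 < a) && (0 < b).
  move=> a0 b0; rewrite !lt0r mulf_eq0 negb_or a0 b0 !andbT mulr_ge0//.
  by rewrite andbT.
apply/seteqP; split => z; rewrite /cyl_bump /ocyl /=.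
  rewrite !B0 ?mulr_ge0 ?bump_ge0// !bump_gt0 !subr_gt0 => /andP[-> /=].
  by rewrite ltr_pXn2r// nnegrE ?enorm_ge0 ?ltW.
move=> /andP[/andP[h1 h2] h3].
by rewrite !B0 ?mulr_ge0 ?bump_ge0// !bump_gt0 !subr_gt0 h1 h2 ltr_pXn2r// nnegrE ?enorm_ge0 ?ltW.
Qed.

Lemma ocyl_open : open ocyl.
Proof. by rewrite -cyl_bumpE; exact: smooth_open smooth_cyl_bump. Qed.

Lemma cyl_bump_compact e : 0 < e -> compact [set z | e <= cyl_bump z].
Proof.
move=> e0.
pose box : set spacetime := `[t1, t2] `*`
  [set x : 'rV[R]_d | forall i, `[x0 ord0 i - r, x0 ord0 i + r]%classic (x ord0 i)].
apply: (@subclosed_compact _ _ box).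
- rewrite -[X in closed X]/(cyl_bump @^-1` [set x | e <= x]).
  apply: closed_comp; last exact: closed_ge.
  by move=> z _; exact/smooth_continuous/smooth_cyl_bump.
- apply: compact_setX; first exact: segment_compact.
  by apply: (@rV_compact R d (fun i => `[x0 ord0 i - r, x0 ord0 i + r]%classic)) => i;
    exact: segment_compact.
- move=> z /= ez; have : ocyl z by rewrite -cyl_bumpE/=; exact: lt_le_trans ez.
  rewrite /ocyl /= => /andP[/andP[h1 h2] h3]; split; first by rewrite /= in_itv/= !ltW.
  move=> i /=; have := le_lt_trans (coord_le_enorm (z.2 - x0) i) h3.
  by rewrite !mxE in_itv/= ltr_norml => /andP[a b]; apply/andP; split; lra.
Qed.

End cylinder_bump.

(** * Weak gradients and translations *)

Section integrable_bounded_factor.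
Context d (T : measurableType d) (R : realType) (mu : {measure set T -> \bar R}).

Lemma integrable_mul_bounded (G psi : T -> R) (M : R) :
  mu.-integrable setT (EFin \o G) -> measurable_fun setT psi ->
  (forall z, `|psi z| <= M) ->
  mu.-integrable setT (fun z => (G z * psi z)%:E).
Proof.
move=> iG mpsi psiM; have mG := measurable_int _ iG.
apply: (@le_integrable _ _ _ _ _ _ _ (fun z => M%:E * (EFin \o G) z)%E) => //.
- by apply/measurable_EFinP/measurable_funM => //; exact/measurable_EFinP.
- move=> z _; rewrite abseM/= -EFinM lee_fin normrM mulrC.
  by rewrite ler_wpM2r// (le_trans (psiM z))// ler_norm.
- exact: integrableZl.
Qed.

End integrable_bounded_factor.

Section sliding.
Context {R : realType} {d : nat}.
Local Notation spacetime := (measurableTypeR R * 'rV[R]_d)%type.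
Local Notation tx := (@lebesgue_tx R d).
Local Notation mu := (@lebesgue_measure R).
Local Open Scope ereal_scope.

Lemma xshiftE (v : 'rV[R]_d) (z : spacetime) : xshift v z = (z.1, z.2 + v)%R.
Proof. by []. Qed.

Lemma measurable_slide (v : 'rV[R]_d) :
  measurable_fun setT (fun q : measurableTypeR R * spacetime => xshift (q.1 *: v) q.2).
Proof.
apply: measurable_fun_pair => /=.
  exact: (measurableT_comp measurable_fst measurable_snd).
apply: measurable_fun_coordP => i.
rewrite (_ : (fun _ => _) = fun q : measurableTypeR R * spacetime =>
  q.2.2 ord0 i + q.1 * v ord0 i)%R; last by apply/funext => q; rewrite !mxE.
apply: measurable_funD.
  apply: (measurableT_comp (measurable_coord i)).
  exact: (measurableT_comp measurable_snd measurable_snd).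
by apply: measurable_funM => //; exact: measurable_fst.
Qed.

Definition unit_itv : R -> R := \1_`[0%R, 1%R].

Lemma measurable_unit_itv : measurable_fun setT (unit_itv : measurableTypeR R -> R).
Proof. by apply: measurable_indic; exact: measurable_itv. Qed.

Lemma integral_unit_itv : \int[mu]_s (unit_itv s)%:E = 1.
Proof.
have mI : measurable (`[0%R, 1%R]%classic : set (measurableTypeR R)).
  exact: measurable_itv.
rewrite /unit_itv integral_indic// setIT.
rewrite [LHS](lebesgue_measure_itv `[0%R, 1%R])/= lte_fin ltr01.
by rewrite -EFinB subr0.
Qed.

Lemma integrable_unit_itv : mu.-integrable setT (EFin \o unit_itv).
Proof.
apply/integrableP; split.
  by apply/measurable_EFinP; exact: measurable_unit_itv.
under eq_integral do rewrite gee0_abs ?lee_fin//.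
by rewrite integral_unit_itv ltry.
Qed.

(** For each s the inner integral is that of G, by translation invariance, and the
weight in s has mass one. *)
Lemma ge0_integral_slide (G : spacetime -> \bar R) (v : 'rV[R]_d) :
  measurable_fun setT G -> (forall z, 0 <= G z) ->
  \int[mu]_s \int[tx]_z ((unit_itv s)%:E * G (xshift (s *: v) z)) = \int[tx]_z G z.
Proof.
move=> mG G0.
transitivity (\int[mu]_s ((unit_itv s)%:E * \int[tx]_z G z)).
  apply: eq_integral => s _.
  rewrite ge0_integralZl//; last by rewrite lee_fin.
  - congr (_ * _); apply: (ge0_integral_measure_preserving (measurable_xshift _)) => //.
    exact: lebesgue_tx_xshift.
  - exact: (measurableT_comp mG (measurable_xshift _)).
rewrite ge0_integralZr//; last exact: integral_ge0.
- by rewrite integral_unit_itv mul1e.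
- by apply/measurable_EFinP; exact: measurable_unit_itv.
- by move=> s _; rewrite lee_fin.
Qed.

Lemma integrable_slide (G : spacetime -> R) (v : 'rV[R]_d) :
  tx.-integrable setT (EFin \o G) ->
  (mu \x tx).-integrable setT
    (fun q => (unit_itv q.1 * G (xshift (q.1 *: v) q.2))%:E).
Proof.
move=> iG; have /integrableP[mG Goo] := iG.
apply/integrable12ltyP.
  apply/measurable_EFinP/measurable_funM.
    exact: (measurableT_comp measurable_unit_itv measurable_fst).
  apply: (measurableT_comp _ (measurable_slide v)).
  by apply/measurable_EFinP.
rewrite [ltLHS](_ : _ = \int[tx]_z `|(G z)%:E|)//.
rewrite -(ge0_integral_slide v)//.
  apply: eq_integral => s _; apply: eq_integral => z _.
  by rewrite EFinM abseM/= ger0_norm.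
exact: measurableT_comp.
Qed.

End sliding.

Section line_integral.
Context {R : realType} {d : nat}.
Local Notation spacetime := (R * 'rV[R]_d)%type.

Lemma is_derive_line (phi : spacetime -> R) (z : spacetime) (w : 'rV[R]_d) (s : R) :
  smooth phi ->
  is_derive s (1 : R) (fun s : R => phi (z.1, z.2 + s *: w))
    ('D_(0, w) phi (z.1, z.2 + s *: w)).
Proof.
move=> sphi; set y := (z.1, z.2 + s *: w).
have dphi : derivable phi y (0, w).
  exact/diff_derivable/smooth_differentiable.
have eqE : (fun h : R => h^-1 *: (phi (h *: (0, w) + y) - phi y)) =
   (fun h : R => h^-1 *: (((fun s : R => phi (z.1, z.2 + s *: w)) \o shift s) (h *: 1)
        - phi y)).
  apply/funext => h; congr (_ *: (phi _ - _)); rewrite /y /=.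
  congr pair; first by rewrite /= scaler0 add0r.
  by rewrite /= [h *: 1]mulr1 scalerDl addrCA.
apply: DeriveDef.
  by move: dphi; rewrite /derivable /= eqE.
by rewrite /derive /= -eqE.
Qed.

Lemma derive_translate (phi : spacetime -> R) (z v : spacetime) (c : 'rV[R]_d) :
  'D_v (fun z : spacetime => phi (z.1, z.2 + c)) z = 'D_v phi (z.1, z.2 + c).
Proof.
rewrite /derive.
rewrite (_ : (fun h : R => h^-1 *: (((fun z => phi (z.1, z.2 + c)) \o shift z) (h *: v)
                - phi (z.1, z.2 + c))) =
  (fun h : R => h^-1 *: ((phi \o shift (z.1, z.2 + c)) (h *: v) - phi (z.1, z.2 + c))))//.
apply/funext => h; congr (_ *: (phi _ - _)).
by congr pair; rewrite /= addrA.
Qed.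

Local Open Scope ereal_scope.

(** Fundamental theorem of calculus along the segment from z to z + w; the weight
[unit_itv] replaces integration over [0, 1] to make Fubini's theorem applicable
on the whole product space. *)
Lemma line_FTC (phi : spacetime -> R) (z : spacetime) (w : 'rV[R]_d) :
  smooth phi ->
  \int[lebesgue_measure]_s (unit_itv s * 'D_(0, w) phi (z.1, z.2 + s *: w))%:E =
  (phi (z.1, z.2 + w) - phi z)%:E.
Proof.
move=> sphi.
pose g (s : R) := phi (z.1, z.2 + s *: w)%R.
have Dg (s : R) : is_derive s (1 : R)%R g ('D_(0%R, w) phi (z.1, z.2 + s *: w)%R).
  exact: is_derive_line.
have cline psi : smooth psi -> continuous (fun s : R => psi (z.1, z.2 + s *: w)%R).
  move=> spsi s; apply/differentiable_continuous/derivable1_diffP.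
  by have [] := is_derive_line z w s spsi.
have -> : phi z = g 0%R by rewrite /g scale0r addr0; case: z {g Dg cline}.
have -> : phi (z.1, z.2 + w)%R = g 1%R by rewrite /g scale1r.
rewrite EFinB.
rewrite -(@continuous_FTC2 _ (fun s => 'D_(0%R, w) phi (z.1, z.2 + s *: w)%R) g 0 1)//.
- rewrite [RHS]integral_mkcond; apply: eq_integral => s _.
  by rewrite patchE /unit_itv indicE; case: ifPn => _; rewrite ?mul1r ?mul0r.
- apply: continuous_subspaceT; apply: (cline ('D_(0%R, w) phi)).
  exact: smooth_derive.
- split.
  + by move=> s _; have [] := Dg s.
  + by apply: cvg_at_right_filter; exact: cline.
  + by apply: cvg_at_left_filter; exact: cline.
- by move=> s _; rewrite derive1E; have [_ ->] := Dg s.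
Qed.

End line_integral.

(** Integrate 2 a k - a^2 <= k^2 over [0, 1]. *)
Lemma unit_itv_jensen (R : realType) (k : R -> R) (a : R) :
  (@lebesgue_measure R).-integrable setT (fun s => (unit_itv s * k s)%:E) ->
  a%:E = (\int[lebesgue_measure]_s (unit_itv s * k s)%:E)%E ->
  ((a ^+ 2)%:E <= \int[lebesgue_measure]_s ((unit_itv s)%:E * (k s ^+ 2)%:E))%E.
Proof.
move=> ik ea; set J := (X in (_ <= X)%E).
have uu s : (unit_itv s) ^+ 2 = unit_itv s :> R.
  by rewrite /unit_itv indicE; case: (_ \in _); rewrite ?expr1n ?expr0n.
have [Joo|] := ltP J +oo%E; last by move=> h; apply: le_trans h; exact: leey.
have mk : measurable_fun setT (fun s : measurableTypeR R => unit_itv s * k s).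
  by apply/measurable_EFinP; exact: measurable_int ik.
have iJ : (@lebesgue_measure R).-integrable setT
    (fun s => ((unit_itv s)%:E * (k s ^+ 2)%:E)%E).
  apply/integrableP; split.
    rewrite (_ : (fun _ => _) = EFin \o (fun s => (unit_itv s * k s) ^+ 2)).
      by apply/measurable_EFinP; exact: measurable_funX.
    by apply/funext => s; rewrite /= exprMn uu EFinM.
  rewrite [X in (X < _)%E](_ : _ = J)//; apply: eq_integral => s _.
  by rewrite gee0_abs// -EFinM lee_fin mulr_ge0 ?sqr_ge0.
have iu := @integrable_unit_itv R.
have -> : (a ^+ 2)%:E = (\int[lebesgue_measure]_s
   ((2 * a)%:E * (unit_itv s * k s)%:E - (a ^+ 2)%:E * (unit_itv s)%:E))%E.
  rewrite integralB//; [|exact: integrableZl|exact: integrableZl].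
  rewrite !integralZl// -ea integral_unit_itv mule1 -EFinM -EFinB.
  by congr EFin; ring.
apply: le_integral => //.
  by apply: integrableB => //; exact: integrableZl.
move=> s _; rewrite -!EFinM -EFinB lee_fin.
have : 0 <= unit_itv s * (k s - a) ^+ 2 by rewrite mulr_ge0 ?sqr_ge0.
by move=> h; rewrite -subr_ge0; move: h; congr (is_true (0 <= _)); ring.
Qed.

Section weak_translation.
Context {R : realType} {d : nat}.
Local Notation spacetime := (measurableTypeR R * 'rV[R]_d)%type.
Local Notation tx := (@lebesgue_tx R d).
Local Notation mu := (@lebesgue_measure R).
Local Open Scope ereal_scope.

Variables (D P : set spacetime) (f : spacetime -> R) (h : spacetime -> 'rV[R]_d).
Hypotheses (mP : measurable P) (PD : P `<=` D) (wg : weak_gradx D f h).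
Hypotheses (iP : tx.-integrable P (EFin \o f))
  (iHP : forall i, tx.-integrable P (fun z => (h z ord0 i)%:E)).

Let F : spacetime -> R := f \_ P.
Let H (v : 'rV[R]_d) : spacetime -> R := (fun z => dot (h z) v) \_ P.
Let U := interior (D : set (R * 'rV[R]_d)).

Let iF : tx.-integrable setT (EFin \o F).
Proof. by rewrite -restrict_EFin; apply/(integrable_mkcond _ mP). Qed.

Let Hi i : spacetime -> R := (fun z => h z ord0 i) \_ P.

Let iHi i : tx.-integrable setT (EFin \o Hi i).
Proof. by rewrite -restrict_EFin; apply/(integrable_mkcond _ mP); exact: iHP. Qed.

Let HE v z : H v z = (\sum_i v ord0 i * Hi i z)%R.
Proof.
rewrite /H /Hi patchE; case: ifPn => zP.
  by apply: eq_bigr => i _; rewrite patchE zP mulrC.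
by rewrite big1// => i _; rewrite patchE (negbTE zP) mulr0.
Qed.

Let iH v : tx.-integrable setT (EFin \o H v).
Proof.
rewrite (_ : _ \o _ = fun z => \sum_i ((v ord0 i)%:E * (EFin \o Hi i) z)).
  by apply: integrable_sum => // i _; exact: integrableZl.
by apply/funext => z; rewrite /= HE -sumEFin; apply: eq_bigr => i _; rewrite EFinM.
Qed.

Let HN v z : H (- v) z = (- H v z)%R.
Proof.
by rewrite !HE -sumrN; apply: eq_bigr => i _; rewrite mxE mulNr.
Qed.

Let integral_restr (g psi : spacetime -> R) (K : set spacetime) : K `<=` P -> supported K psi ->
  \int[tx]_(z in D) (g z * psi z)%:E = \int[tx]_z ((g \_ P) z * psi z)%:E.
Proof.
move=> KP sK; rewrite integral_mkcond; apply: eq_integral => z _.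
rewrite !patchE; case: (boolP (z \in P)) => zP.
  by rewrite (mem_set (PD (set_mem zP))).
rewrite mul0r; case: ifPn => // _; rewrite sK ?mulr0// => /KP/mem_set.
by rewrite (negbTE zP).
Qed.

(** The definition of the weak gradient only involves the coordinate directions;
directional derivatives of test functions are linear in the direction. *)
Let weak_dir phi (K : set (R * 'rV[R]_d)) v : smooth phi -> compact K ->
  K `<=` P -> K `<=` U -> supported K phi ->
  \int[tx]_z (F z * 'D_(0%R, v) phi z)%:E = - \int[tx]_z (H v z * phi z)%:E.
Proof.
move=> sphi cK KP KU sK; have [_ _ _ wi] := wg.
have tphi : test_function U phi by exact: test_function_smooth KU.
have [M phiM] := smooth_bounded sphi cK sK.
have smD w : smooth ('D_w phi) by exact: smooth_derive.
have int1 i : tx.-integrable setT (fun z => (F z * 'D_(0%R, delta_mx ord0 i) phi z)%:E).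
  have [M' M'P] := smooth_bounded (smD (0, delta_mx ord0 i)%R) cK (supported_derive _ cK sK).
  exact: (integrable_mul_bounded iF (measurable_smooth (smD _)) M'P).
have int2 i : tx.-integrable setT (fun z => (Hi i z * phi z)%:E).
  exact: (integrable_mul_bounded (iHi i) (measurable_smooth sphi) phiM).
have eqi i : \int[tx]_z (F z * 'D_(0%R, delta_mx ord0 i) phi z)%:E
    = - \int[tx]_z (Hi i z * phi z)%:E.
  have := wi phi tphi i; rewrite /Rintegral.
  rewrite (integral_restr _ KP (supported_derive _ cK sK)) (integral_restr _ KP sK).
  have f1 := integrable_fin_num measurableT (int1 i).
  have f2 := integrable_fin_num measurableT (int2 i).
  by move=> e; rewrite -(fineK f1) -(fineK f2) -EFinN; congr EFin.
transitivity (\int[tx]_z (\sum_i ((v ord0 i)%:E * (F z * 'D_(0%R, delta_mx ord0 i) phi z)%:E))).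
  apply: eq_integral => z _; rewrite smooth_derive_dir// mulr_sumr -sumEFin.
  by apply: eq_bigr => i _; rewrite -EFinM mulrCA.
rewrite integral_sum//; last by move=> i; exact: integrableZl.
transitivity (- \int[tx]_z (\sum_i ((v ord0 i)%:E * (Hi i z * phi z)%:E))); last first.
  congr (- _); apply: eq_integral => z _; rewrite HE mulr_suml -sumEFin.
  by apply: eq_bigr => i _; rewrite -EFinM mulrA.
rewrite integral_sum//; last by move=> i; exact: integrableZl.
rewrite -sumeN; last first.
  move=> i j _ _; apply: fin_num_adde_defl; apply: integrable_fin_num => //.
  exact: integrableZl.
apply: eq_bigr => i _.
by rewrite !integralZl// eqi muleN.
Qed.

Let integral_xshift (g : spacetime -> R) v : tx.-integrable setT (EFin \o g) ->
  \int[tx]_z (g (xshift v z))%:E = \int[tx]_z (g z)%:E.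
Proof.
move=> ig; have := integral_measure_preserving (measurable_xshift v)
  (@lebesgue_tx_xshift R d v) ig.
by [].
Qed.

Let measurable_line_smooth psi (w : 'rV[R]_d) : smooth psi ->
  measurable_fun setT (fun q : measurableTypeR R * spacetime =>
     psi (xshift (q.1 *: w) q.2)).
Proof.
move=> spsi; exact: (measurableT_comp (measurable_smooth spsi) (measurable_slide w)).
Qed.

(** The translation is moved to the test function, where the difference is an
integral of derivatives along a segment. The definition of the weak gradient
applies to each translate of the test function, and a change of variables brings
the translation back onto the gradient. *)
Lemma weak_shift phi (K : set (R * 'rV[R]_d)) v : smooth phi -> compact K ->
  supported K phi ->
  (forall s z, (0 <= s <= 1)%R -> K z ->
     P (xshift (s *: v) z) /\ U (xshift (s *: v) z)) ->
  \int[tx]_z ((F (xshift v z) - F z)%:E * (phi z)%:E) =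
  \int[tx]_z ((\int[mu]_s (unit_itv s * H v (xshift (s *: v) z))%:E) * (phi z)%:E).
Proof.
move=> sphi cK sK KPU.
have [M phiM] := smooth_bounded sphi cK sK.
set w := (- v)%R.
have mphi := measurable_smooth sphi.
have sD : smooth ('D_(0%R, w) phi) by exact: smooth_derive.
have [M' DphiM] := smooth_bounded sD cK (supported_derive _ cK sK).
have iFv : tx.-integrable setT (EFin \o (fun z => F (xshift v z))).
  by have := integrable_measure_preserving (measurable_xshift v)
    (@lebesgue_tx_xshift R d v) iF.
have iFphi : tx.-integrable setT (fun z => (F z * phi z)%:E).
  exact: (integrable_mul_bounded iF mphi phiM).
have iFvphi : tx.-integrable setT (fun z => (F (xshift v z) * phi z)%:E).
  exact: (integrable_mul_bounded iFv mphi phiM).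
have iFphiv : tx.-integrable setT (fun z => (F z * phi (xshift w z))%:E).
  apply: (integrable_mul_bounded (psi := fun z => phi (xshift w z))) => //.
  exact: (measurableT_comp mphi (measurable_xshift _)).
(* change of variables z -> z - v in the translated term only *)
transitivity (\int[tx]_z (F z * (phi (xshift w z) - phi z))%:E).
  under eq_integral do rewrite -EFinM mulrBl EFinB.
  rewrite integralB//.
  under [in RHS]eq_integral do rewrite mulrBr EFinB.
  rewrite integralB//; congr (_ - _).
  rewrite -[RHS](integral_xshift v (g := fun z => (F z * phi (xshift w z))%R) iFphiv).
  apply: eq_integral => z _.
  by rewrite /w; case: z => t x; rewrite /xshift/= addrK.
transitivity (\int[tx]_z \int[mu]_s (unit_itv s * F z *
    'D_(0%R, w) phi (xshift (s *: w) z))%:E).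
  apply: eq_integral => z _.
  have := line_FTC z w sphi => e.
  rewrite EFinM -[X in _ * X]e -integralZl//.
    by apply: eq_integral => s _; rewrite -EFinM mulrCA mulrA.
  apply: (@integrable_mul_bounded _ _ _ _ (unit_itv : measurableTypeR R -> R)
    (fun s => 'D_(0%R, w) phi (z.1, z.2 + s *: w)%R) M') => //.
  - exact: integrable_unit_itv.
  - exact: (measurableT_comp (measurable_line_smooth w sD) (pair2_measurable z)).
have iq : (mu \x tx).-integrable setT (fun q : measurableTypeR R * spacetime =>
   (unit_itv q.1 * F q.2 * 'D_(0%R, w) phi (xshift (q.1 *: w) q.2))%:E).
  apply: (integrable_mul_bounded
    (G := fun q : measurableTypeR R * spacetime => (unit_itv q.1 * F q.2)%R)
    (psi := fun q => 'D_(0%R, w) phi (xshift (q.1 *: w) q.2))) => //.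
    have := integrable_slide 0 iF.
    by under eq_fun do rewrite scaler0 xshiftE addr0 -surjective_pairing.
  exact: (measurable_line_smooth w sD).
rewrite -(Fubini (m1 := mu) (m2 := tx)
  (f := fun q => (unit_itv q.1 * F q.2 * 'D_(0%R, w) phi (xshift (q.1 *: w) q.2))%:E))//=.
have iq2 : (mu \x tx).-integrable setT (fun q : measurableTypeR R * spacetime =>
   (unit_itv q.1 * H v (xshift (q.1 *: v) q.2) * phi q.2)%:E).
  apply: (integrable_mul_bounded
    (G := fun q : measurableTypeR R * spacetime => (unit_itv q.1 * H v (xshift (q.1 *: v) q.2))%R)
    (psi := fun q => phi q.2)) => //.
    exact: integrable_slide.
  exact: (measurableT_comp mphi measurable_snd).
transitivity (\int[tx]_z \int[mu]_s (unit_itv s * H v (xshift (s *: v) z) * phi z)%:E); last first.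
  have iq0 := integrable_slide v (iH v).
  apply: ae_eq_integral => //.
  - exact: (measurable_fubini_G iq2).
  - apply: emeasurable_funM; last by apply/measurable_EFinP.
    exact: (measurable_fubini_G iq0).
  - have := ae_integrable2 iq0; apply: filterS => z /= iz _.
    by rewrite -integralZr.
rewrite -(Fubini (m1 := mu) (m2 := tx)
  (f := fun q => (unit_itv q.1 * H v (xshift (q.1 *: v) q.2) * phi q.2)%:E))//=.
apply: eq_integral => s _.
rewrite /unit_itv indicE; case: (boolP (s \in _)) => /= s01; last first.
  by under eq_integral do rewrite !mul0r; under [RHS]eq_integral do rewrite !mul0r.
under eq_integral do rewrite mul1r.
under [RHS]eq_integral do rewrite mul1r.
have s1 : (0 <= s <= 1)%R by move/set_mem: s01; rewrite /= in_itv.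
(* for fixed s, test against the translate of phi by s v *)
pose phis z := phi (xshift (s *: w) z).
have sphis : smooth phis by exact: smooth_xshift.
pose ys (z : R * 'rV[R]_d) : R * 'rV[R]_d := (z.1, z.2 + s *: v)%R.
pose Ks := ys @` K.
have svw (z : spacetime) : xshift (s *: v) (xshift (s *: w) z) = z.
  by rewrite /w; case: z => t x; rewrite /xshift/= scalerN subrK.
have swv (z : spacetime) : xshift (s *: w) (xshift (s *: v) z) = z.
  by rewrite /w; case: z => t x; rewrite /xshift/= scalerN addrK.
have cKs : compact Ks.
  apply: continuous_compact => //; apply: continuous_subspaceT => z.
  rewrite (_ : ys = fun z => z + (0, s *: v))%R; first by apply: cvgD; [exact: cvg_id|exact: cvg_cst].
  by apply/funext => -[t x]; congr pair; rewrite /= addr0.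
have sKs : supported Ks phis.
  move=> z nKz; apply: sK => Kz; apply: nKz.
  by exists (xshift (s *: w) z).
have KsP : Ks `<=` P by move=> _ [z Kz <-]; have [] := KPU s z s1 Kz.
have KsU : Ks `<=` U by move=> _ [z Kz <-]; have [] := KPU s z s1 Kz.
transitivity (\int[tx]_z (F z * 'D_(0%R, w) phis z)%:E).
  apply: eq_integral => z _; congr (_ * _)%:E.
  by rewrite -derive_translate.
rewrite (weak_dir w sphis cKs KsP KsU sKs).
have iHphis : tx.-integrable setT (fun z => (H v z * phi (xshift (s *: w) z))%:E).
  apply: (integrable_mul_bounded (psi := fun z => phi (xshift (s *: w) z)) (iH v)).
    exact: (measurableT_comp mphi (measurable_xshift _)).
  by move=> z; exact: phiM.
have -> : \int[tx]_z (H w z * phis z)%:E =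
    - \int[tx]_z (H v z * phi (xshift (s *: w) z))%:E.
  rewrite -integralN; last exact: integrable_add_def iHphis.
  by apply: eq_integral => z _; rewrite HN mulNr EFinN.
rewrite oppeK.
rewrite -[LHS](integral_xshift (s *: v) (g := fun z => (H v z * phi (xshift (s *: w) z))%R) iHphis).
by apply: eq_integral => z _; rewrite swv.
Qed.

(** [weak_shift] and the fundamental lemma identify the difference with the integral
of the gradient along the segment, almost everywhere on the small cylinder;
Jensen's inequality and Tonelli's theorem then give the bound. *)
Lemma shift_sqr_le (v : 'rV[R]_d) t1 t2 (x0 : 'rV[R]_d) r : (0 < r)%R ->
  (forall s z, (0 <= s <= 1)%R -> ocyl t1 t2 x0 r z ->
     P (xshift (s *: v) z) /\ U (xshift (s *: v) z)) ->
  \int[tx]_(z in ocyl t1 t2 x0 r) ((F (xshift v z) - F z) ^+ 2)%:E <=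
  \int[tx]_z ((H v z) ^+ 2)%:E.
Proof.
move=> r0 OPU; set O := ocyl _ _ _ _.
have iFv : tx.-integrable setT (EFin \o (fun z => F (xshift v z))).
  by have := integrable_measure_preserving (measurable_xshift v)
    (@lebesgue_tx_xshift R d v) iF.
have i1 : tx.-integrable setT (fun z => (F (xshift v z) - F z)%:E).
  by under eq_fun do rewrite EFinB; exact: integrableB.
have iq := integrable_slide v (iH v).
have mq := measurable_int _ iq.
pose G2 z := \int[mu]_s (unit_itv s * H v (xshift (s *: v) z))%:E.
have i2 : tx.-integrable setT G2.
  apply/integrableP; split; first exact: (measurable_fubini_G iq).
  apply: le_lt_trans ((integrable21ltyP _ _ mq).1 iq).
  apply: ge0_le_integral => //.
  - by apply: measurableT_comp => //; exact: (measurable_fubini_G iq).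
  - apply: (measurable_fun_fubini_tonelli_G (m1 := mu)
      (fun q => `|(unit_itv q.1 * H v (xshift (q.1 *: v) q.2))%:E|)) => //.
    exact: measurableT_comp.
  - move=> z _; apply: le_abse_integral => //.
    exact: (measurableT_comp mq (pair2_measurable z)).
have mO : measurable (O : set spacetime).
  rewrite /O -(cyl_bumpE t1 t2 x0 r0).
  rewrite (_ : [set z | _] = cyl_bump t1 t2 x0 r @^-1` `]0%R, +oo[%classic); last first.
    by apply/seteqP; split => z /=; rewrite in_itv/= andbT.
  rewrite -[X in measurable X]setTI.
  by apply: (measurable_smooth (smooth_cyl_bump t1 t2 x0 r)) => //.
have ae12 : ae_eq tx O (fun z => (F (xshift v z) - F z)%:E) G2.
  rewrite /O -(cyl_bumpE t1 t2 x0 r0); apply: ae_eq_of_smooth => //.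
    exact: smooth_cyl_bump.
  move=> phi e sphi e0 phie.
  have sK : supported [set z | (e <= cyl_bump t1 t2 x0 r z)%R] phi.
    by move=> z; apply: contra_notP => /eqP/phie.
  apply: (weak_shift sphi (@cyl_bump_compact R d t1 t2 x0 r r0 e e0) sK).
  move=> s z s01 ez; apply: OPU => //.
  by rewrite -(cyl_bumpE t1 t2 x0 r0)/=; exact: lt_le_trans ez.
have msq : measurable_fun setT (fun q : measurableTypeR R * spacetime =>
    ((unit_itv q.1)%:E * ((H v (xshift (q.1 *: v) q.2)) ^+ 2)%:E)).
  apply: emeasurable_funM; apply/measurable_EFinP.
    exact: (measurableT_comp measurable_unit_itv measurable_fst).
  apply: measurable_funX.
  have mHv : measurable_fun setT (H v) by apply/measurable_EFinP; exact: measurable_int (iH v).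
  exact: (measurableT_comp mHv (measurable_slide v)).
have sq0 q : 0 <= (fun q : measurableTypeR R * spacetime =>
    ((unit_itv q.1)%:E * ((H v (xshift (q.1 *: v) q.2)) ^+ 2)%:E)) q.
  by rewrite -EFinM lee_fin mulr_ge0 ?sqr_ge0.
have mJ := measurable_fun_fubini_tonelli_G (m1 := mu) _ msq sq0.
apply: (@le_trans _ _ (\int[tx]_z \int[mu]_s
    ((unit_itv s)%:E * ((H v (xshift (s *: v) z)) ^+ 2)%:E))); last first.
  rewrite -(fubini_tonelli (m1 := mu) (m2 := tx) _ msq sq0)/=.
  rewrite (ge0_integral_slide v (G := fun z => ((H v z) ^+ 2)%:E))//.
    by apply/measurable_EFinP/measurable_funX/measurable_EFinP; exact: measurable_int (iH v).
  by move=> z; rewrite lee_fin sqr_ge0.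
apply: (@le_trans _ _ (\int[tx]_(z in O) \int[mu]_s
    ((unit_itv s)%:E * ((H v (xshift (s *: v) z)) ^+ 2)%:E))); last first.
  apply: ge0_subset_integral => //.
  by move=> z _; apply: integral_ge0 => s _; exact: (sq0 (s, z)).
apply: ae_ge0_le_integral => //.
- by move=> z _; rewrite lee_fin sqr_ge0.
- apply: measurable_funTS; apply/measurable_EFinP/measurable_funX/measurable_EFinP.
  exact: measurable_int i1.
- by move=> z _; apply: integral_ge0 => s _; exact: (sq0 (s, z)).
- exact: measurable_funTS.
have aei := ae_integrable2 iq.
move: ae12 aei; apply: filterS2 => z /= eqz iz Oz.
exact: unit_itv_jensen (eqz Oz).
Qed.

End weak_translation.

Section translation_estimate.
Context {R : realType} {d : nat}.
Local Notation spacetime := (measurableTypeR R * 'rV[R]_d)%type.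
Local Notation tx := (@lebesgue_tx R d).
Local Open Scope ereal_scope.

Lemma integrable_of_sqr d' (T : measurableType d') (mu : {measure set T -> \bar R})
    (P : set T) (f : T -> R) : measurable P -> mu P < +oo ->
  measurable_fun P f -> \int[mu]_(z in P) (f z ^+ 2)%:E < +oo ->
  mu.-integrable P (EFin \o f).
Proof.
move=> mP Poo mf foo; apply/integrableP; split; first exact/measurable_EFinP.
apply: (@le_lt_trans _ _ (\int[mu]_(z in P) (1 + (f z ^+ 2)%:E))).
  apply: ge0_le_integral => //.
  - by apply: measurableT_comp => //; exact/measurable_EFinP.
  - apply: emeasurable_funD => //; apply/measurable_EFinP; exact: measurable_funX.
  - move=> z _; rewrite /= -EFinD lee_fin.
    have [f1|f1] := leP (`|f z|)%R 1%R; first by rewrite (le_trans f1)// lerDl sqr_ge0.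
    rewrite -real_normK ?num_real// expr2.
    have := normr_ge0 (f z) => f0.
    have : (`|f z| * 1 <= `|f z| * `|f z|)%R by rewrite ler_wpM2l// ltW.
    by rewrite mulr1; lra.
rewrite ge0_integralD//; last 2 first.
- by move=> z _; rewrite lee_fin sqr_ge0.
- by apply/measurable_EFinP; exact: measurable_funX.
by rewrite integral_cst// mul1e lte_add_pinfty.
Qed.

(** The final time slice is negligible. *)
Lemma integral_cylinder_ocyl a b (y : 'rV[R]_d) l (g : spacetime -> \bar R) :
  measurable_fun (cylinder a b y l) g ->
  (forall z, cylinder a b y l z -> 0 <= g z) ->
  \int[tx]_(z in cylinder a b y l) g z = \int[tx]_(z in ocyl a b y l) g z.
Proof.
move=> mg g0; pose N : set spacetime := [set b] `*` setT.
have mN : measurable N by apply: measurableX.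
have N0 : tx N = 0.
  rewrite [LHS]product_measure1E//.
  by rewrite [X in X * _](lebesgue_measure_set1 b) mul0e.
rewrite (ge0_negligible_integral mN _ mg g0 N0); last exact: measurable_cylinder.
congr (\int[tx]_(z in _) g z); apply/seteqP; split => -[t x].
  move=> [[/= tab xl] nb]; rewrite /ocyl /=; move: tab; rewrite in_itv/= => /andP[ta tb].
  rewrite ta xl andbT lt_neqAle tb andbT; apply/eqP => e; apply: nb; split => //=.
rewrite /ocyl /= => /andP[/andP[ta tb] xl]; split.
  by split => //=; rewrite in_itv/= ta ltW.
by move=> [/= e _]; rewrite e ltxx in tb.
Qed.

(** The L^2 modulus of continuity in space of a function with square integrable
weak gradient. Since [enorm v <= r2 - r1], the segments from points of the small
cylinder stay in the large one. *)
Lemma translation_estimate (a b : R) (y : 'rV[R]_d) (l : R)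
    (f : spacetime -> R) (h : spacetime -> 'rV[R]_d) (X0 : spacetime) (r1 r2 : R)
    (v : 'rV[R]_d) :
  let P := pcyl X0 r2 in
  (0 < r1 < r2)%R -> P `<=` cylinder a b y l ->
  weak_gradx (cylinder a b y l) f h -> measurable_fun (cylinder a b y l) f ->
  \int[tx]_(z in P) (f z ^+ 2)%:E < +oo ->
  \int[tx]_(z in P) (enorm (h z) ^+ 2)%:E < +oo ->
  (enorm v <= r2 - r1)%R ->
  \int[tx]_(z in ocyl (X0.1 - r1 ^+ 2) X0.1 X0.2 r1)
     (((f \_ P) (xshift v z) - (f \_ P) z) ^+ 2)%:E <=
  (enorm v ^+ 2)%:E * \int[tx]_(z in P) (enorm (h z) ^+ 2)%:E.
Proof.
move=> P /andP[r10 r12] PQ wg mf foo hoo vr.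
have mP : measurable P by exact: measurable_cylinder.
have mQ : measurable (cylinder a b y l) by exact: measurable_cylinder.
have Poo : tx P < +oo by exact: cylinder_lty.
have [_ mh _ _] := wg.
have mfP : measurable_fun P f by exact: measurable_funS mf.
have mhP i : measurable_fun P (fun z => h z ord0 i) by exact: measurable_funS (mh i).
have iP := integrable_of_sqr mP Poo mfP foo.
have menorm : measurable_fun P (fun z => enorm (h z) ^+ 2)%R.
  rewrite (_ : (fun _ => _) = fun z => \sum_i h z ord0 i ^+ 2)%R; last first.
    by apply/funext => z; rewrite enorm_sqr.
  by apply: measurable_sum => i; exact: measurable_funX.
have iHP i : tx.-integrable P (fun z => (h z ord0 i)%:E).
  apply: (@integrable_of_sqr _ _ tx P (fun z => h z ord0 i)) => //.
  apply: le_lt_trans hoo; apply: ge0_le_integral => //.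
  - by move=> z _; rewrite lee_fin sqr_ge0.
  - by apply/measurable_EFinP; exact: measurable_funX.
  - exact/measurable_EFinP.
  - move=> z _; rewrite lee_fin -(ler_sqrt _ (sqr_ge0 _)) !sqrtr_sqr.
    by rewrite (ger0_norm (enorm_ge0 _)) coord_le_enorm.
have OPU s z : (0 <= s <= 1)%R -> ocyl (X0.1 - r1 ^+ 2) X0.1 X0.2 r1 z ->
    P (xshift (s *: v) z) /\
    interior (cylinder a b y l : set (R * 'rV[R]_d)) (xshift (s *: v) z).
  move=> /andP[s0 s1]; rewrite {1}/ocyl /= => /andP[/andP[ta tb] xl].
  have r12' : (r1 ^+ 2 < r2 ^+ 2)%R by rewrite ltr_pXn2r// nnegrE ltW// (lt_trans r10).
  have xs : eball X0.2 r2 (z.2 + s *: v)%R.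
    apply: (eballD (r := r1)) => //.
    by rewrite enormZ// (le_trans _ vr)// ler_piMl// enorm_ge0.
  have Os : ocyl (X0.1 - r2 ^+ 2) X0.1 X0.2 r2 (xshift (s *: v) z).
    by rewrite /ocyl /= tb xs andbT/= andbT; lra.
  have OP : ocyl (X0.1 - r2 ^+ 2) X0.1 X0.2 r2 `<=` P.
    move=> q; rewrite /ocyl /= => /andP[/andP[qa qb] ql]; split => //=.
    by rewrite in_itv/= qa ltW.
  split; first exact: OP.
  have : nbhs (xshift (s *: v) z : R * 'rV[R]_d) (ocyl (X0.1 - r2 ^+ 2) X0.1 X0.2 r2).
    apply: open_nbhs_nbhs; split => //; apply: ocyl_open.
    exact: lt_trans r12.
  by apply: filterS => q /OP /PQ.
have := shift_sqr_le mP PQ wg iP iHP r10 OPU; move/le_trans; apply.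
rewrite -ge0_integralZl//; last 3 first.
- exact/measurable_EFinP.
- by move=> z _; rewrite lee_fin sqr_ge0.
- by rewrite lee_fin sqr_ge0.
rewrite [leRHS]integral_mkcond; apply: ge0_le_integral => //.
- by move=> z _; rewrite lee_fin sqr_ge0.
- apply/measurable_EFinP; apply: measurable_funX.
  apply/(measurable_restrictT _ mP); apply: measurable_sum => i.
  by apply: measurable_funM.
- apply/(measurable_restrictT _ mP); apply: emeasurable_funM => //.
  exact/measurable_EFinP.
- move=> z _; rewrite !patchE; case: ifPn => _; last by rewrite expr0n.
  by rewrite -EFinM lee_fin mulrC dot_sqr_le.
Qed.

End translation_estimate.

(** * A Nash type inequality *)

Section cauchy_schwarz.
Local Open Scope ereal_scope.
Context d (T : measurableType d) (R : realType) (mu : {measure set T -> \bar R}).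

(** The Cauchy-Schwarz inequality for g and the indicator of {g > 0}, from
2 g <= lam g^2 + 1/lam on {g > 0} optimized in lam. The right-hand side may be
infinite. *)
Lemma integral_sqr_le_support (g : T -> R) (S : R) :
  measurable_fun setT g -> (forall x, 0 <= g x)%R -> (0 < S)%R ->
  \int[mu]_x (g x ^+ 2)%:E <= S%:E ->
  (\int[mu]_x (g x)%:E) * (\int[mu]_x (g x)%:E) <= S%:E * mu [set x | (0 < g x)%R].
Proof.
move=> mg g0 S0 gS; set A := [set x | _]; set I := \int[mu]_x _.
have mA : measurable A.
  rewrite (_ : A = g @^-1` `]0%R, +oo[%classic); last first.
    by apply/seteqP; split => z /=; rewrite in_itv/= andbT.
  by rewrite -[X in measurable X]setTI; exact: mg.
have I0 : 0 <= I by apply: integral_ge0 => x _; rewrite lee_fin.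
have [Ay|Ay] := eqVneq (mu A) +oo; first by rewrite Ay gt0_muley ?lte_fin// leey.
have Afin : mu A \is a fin_num by rewrite ge0_fin_numE// ltey.
have young (lam : R) : (0 < lam)%R -> 2%:E * I <= (lam * S + fine (mu A) / lam)%:E.
  move=> l0; rewrite -ge0_integralZl//; last 2 first.
  - exact/measurable_EFinP.
  - by move=> x _; rewrite lee_fin.
  apply: (@le_trans _ _ (\int[mu]_x (lam%:E * (g x ^+ 2)%:E + (lam^-1)%:E * (\1_A x)%:E))).
    apply: ge0_le_integral => //.
    - by move=> x _; rewrite -EFinM lee_fin mulr_ge0.
    - by apply: emeasurable_funM => //; exact/measurable_EFinP.
    - apply: emeasurable_funD; apply: emeasurable_funM => //.
        by apply/measurable_EFinP; exact: measurable_funX.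
      by apply/measurable_EFinP; exact: measurable_indic.
    move=> x _; rewrite -!EFinM -EFinD lee_fin indicE.
    case: (ltP 0 (g x))%R => gx.
      rewrite mem_set// mulr1 -subr_ge0.
      rewrite (_ : _ - _ = lam * (g x - lam^-1) ^+ 2)%R.
        by rewrite mulr_ge0 ?sqr_ge0 ?ltW.
      by field; rewrite gt_eqF.
    have -> : g x = 0%R by apply/eqP; rewrite eq_le gx g0.
    by rewrite mulr0 expr0n /= mulr0 add0r mulr_ge0// invr_ge0 ltW.
  rewrite ge0_integralD//; last 4 first.
  - by move=> x _; rewrite -EFinM lee_fin mulr_ge0// ?sqr_ge0// ltW.
  - by apply: emeasurable_funM => //; apply/measurable_EFinP; exact: measurable_funX.
  - by move=> x _; rewrite -EFinM lee_fin mulr_ge0// invr_ge0 ltW.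
  - by apply: emeasurable_funM => //; apply/measurable_EFinP; exact: measurable_indic.
  have m1 : measurable_fun setT (fun x => (\1_A x)%:E : \bar R).
    by apply/measurable_EFinP; exact: measurable_indic.
  have m2 : measurable_fun setT (fun x => (g x ^+ 2)%:E).
    by apply/measurable_EFinP; exact: measurable_funX.
  rewrite (ge0_integralZl mu measurableT m1)//; last by rewrite lee_fin invr_ge0 ltW.
  rewrite (ge0_integralZl mu measurableT m2)//; last 2 first.
  - by move=> x _; rewrite lee_fin sqr_ge0.
  - by rewrite lee_fin ltW.
  rewrite integral_indic// setIT EFinD !EFinM (fineK Afin) [X in _ <= _ + X]muleC.
  by rewrite leeD2r// lee_wpmul2l// lee_fin ltW.
have Ifin : I \is a fin_num.
  have := young 1%R ltr01.
  by case: (I) I0 => [r //||//] _; rewrite gt0_muley ?lte_fin// leye_eq.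
move: young; rewrite -(fineK Ifin) -(fineK Afin).
have : (0 <= fine I)%R by exact: fine_ge0.
have : (0 <= fine (mu A))%R by exact: fine_ge0.
move: (fine I) (fine (mu A)) => i m m0 i0 young.
rewrite -!EFinM lee_fin; have [i00|ipos] := eqVneq i 0%R.
  by rewrite i00 mul0r mulr_ge0// ltW.
have igt0 : (0 < i)%R by rewrite lt0r ipos.
have := young (i / S)%R (divr_gt0 igt0 S0).
rewrite -EFinM lee_fin (_ : i / S * S + m / (i / S) = i + m * S / i)%R; last first.
  by field; rewrite !gt_eqF.
rewrite mulrDl !mul1r lerD2l ler_pdivlMr// mulrC.
by rewrite [(m * S)%R]mulrC.
Qed.

End cauchy_schwarz.

Section nash.
Context {R : realType} {d : nat}.
Local Notation spacetime := (measurableTypeR R * 'rV[R]_d)%type.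
Local Notation tx := (@lebesgue_tx R d).
Local Notation mu := (@lebesgue_measure R).
Local Notation nu := (lebesgue_rV R d).
Local Open Scope ereal_scope.

Definition cube (eta : R) : set 'rV[R]_d :=
  [set x | forall i, `[0%R, eta]%classic (x ord0 i)].

Lemma measurable_cube eta : measurable (cube eta).
Proof.
rewrite [X in measurable X](_ : _ = \bigcap_(i in [set: 'I_d])
    ((fun x : 'rV[R]_d => x ord0 i) @^-1` `[0%R, eta]%classic)); last first.
  by apply/seteqP; split => x /= h i => [_|]; exact: h.
apply: fin_bigcap_measurable => // i _; rewrite -[X in measurable X]setTI.
by apply: measurable_coord => //; exact: measurable_itv.
Qed.

Lemma lebesgue_rV_cube eta : (0 < eta)%R -> nu (cube eta) = (eta ^+ d)%:E.
Proof.
move=> e0; rewrite /cube (lebesgue_rV_box (A := fun=> `[0%R, eta]%classic)); last first.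
  by move=> i; exact: measurable_itv.
transitivity (\prod_(i < d) eta%:E); last by rewrite prodEFin prodr_const card_ord.
apply: eq_bigr => i _.
by rewrite [LHS](lebesgue_measure_itv `[0%R, eta])/= lte_fin e0 -EFinB subr0.
Qed.

(** The sharp factor is the square root of d; d avoids square roots in the choice of
the side of the cube. *)
Lemma enorm_cube eta x : (0 <= eta)%R -> cube eta x -> (enorm x <= d%:R * eta)%R.
Proof.
move=> e0 ex; rewrite -(@ler_pXn2r _ 2)// ?nnegrE ?enorm_ge0 ?mulr_ge0//.
rewrite enorm_sqr (@le_trans _ _ (\sum_(i < d) eta ^+ 2)%R)//.
  apply: ler_sum => i _; have := ex i; rewrite /= in_itv/= => /andP[x0 x1].
  by rewrite ler_pXn2r// nnegrE.
rewrite sumr_const card_ord exprMn -[leLHS]mulr_natl ler_wpM2r ?sqr_ge0//.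
by rewrite -natrX ler_nat; case: (d) => // n; rewrite leq_pmulr.
Qed.

(** Integrate w(z)^2 <= (w(z + v) - w(z))^2 + 2 w(z) w(z + v) over v in the cube and
z in P1. In the mixed term the cube is enlarged to the whole space: integrating
first in v gives, by translation invariance, the square of the slice integral
of w, and [integral_sqr_le_support] applies on almost every slice. *)
Lemma nash (w : spacetime -> R) (P1 : set spacetime) (eta E : R) :
  measurable_fun setT w -> (forall z, 0 <= w z)%R -> measurable P1 ->
  (0 < eta)%R -> (0 < E)%R ->
  (forall v, (enorm v <= d%:R * eta)%R ->
    \int[tx]_(z in P1) ((w (xshift v z) - w z) ^+ 2)%:E <= ((d%:R * eta) ^+ 2 * E)%:E) ->
  {ae mu, forall t, \int[nu]_x (w (t, x) ^+ 2)%:E <= E%:E} ->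
  (eta ^+ d)%:E * \int[tx]_(z in P1) (w z ^+ 2)%:E <=
  (eta ^+ d)%:E * ((d%:R * eta) ^+ 2 * E)%:E
    + 2%:E * (E%:E * tx [set z | (0 < w z)%R]).
Proof.
move=> mw w0 mP1 eta0 E0 H1 H2.
pose sh (q : 'rV[R]_d * spacetime) : spacetime := xshift q.1 q.2.
have msh : measurable_fun setT sh.
  apply: measurable_fun_pair => /=.
    exact: (measurableT_comp measurable_fst measurable_snd).
  apply: measurable_fun_coordP => i.
  rewrite (_ : (fun _ => _) = fun q : 'rV[R]_d * spacetime =>
    q.2.2 ord0 i + q.1 ord0 i)%R; last by apply/funext => q; rewrite !mxE.
  apply: measurable_funD; apply: (measurableT_comp (measurable_coord i)).
    exact: (measurableT_comp measurable_snd measurable_snd).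
  exact: measurable_fst.
have mshv v : measurable_fun setT (fun z => w (xshift v z)).
  exact: (measurableT_comp mw (measurable_xshift v)).
pose c (q : 'rV[R]_d * spacetime) : R := (w q.2 * w (sh q))%R.
have mc : measurable_fun setT (EFin \o c).
  apply/measurable_EFinP; apply: measurable_funM.
    exact: (measurableT_comp mw measurable_snd).
  exact: (measurableT_comp mw msh).
have c0 q : 0 <= (EFin \o c) q by rewrite lee_fin mulr_ge0.
have mF := measurable_fun_fubini_tonelli_F (m2 := tx) _ mc c0.
have mG := measurable_fun_fubini_tonelli_G (m1 := nu) _ mc c0.
set L := \int[tx]_(z in P1) (w z ^+ 2)%:E.
have step v : cube eta v -> L <= ((d%:R * eta) ^+ 2 * E)%:E +
    2%:E * \int[tx]_z (c (v, z))%:E.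
  move=> /enorm_cube => /(_ (ltW eta0))/H1 h1.
  apply: (@le_trans _ _ (\int[tx]_(z in P1) (((w (xshift v z) - w z) ^+ 2)%:E +
      2%:E * (c (v, z))%:E))).
    apply: ge0_le_integral => //.
    - by move=> z _; rewrite lee_fin sqr_ge0.
    - by apply: measurable_funTS; apply/measurable_EFinP; exact: measurable_funX.
    - apply: measurable_funTS; apply: emeasurable_funD.
        by apply/measurable_EFinP; apply: measurable_funX; exact: measurable_funB.
      apply: emeasurable_funM => //.
      exact: (measurableT_comp mc (pair1_measurable v)).
    - move=> z _; rewrite -EFinM -EFinD lee_fin /c /sh /=.
      move: (w (xshift v z)) (w z) => b a; rewrite -subr_ge0.
      by rewrite [X in (0 <= X)%R](_ : _ = b ^+ 2)%R ?sqr_ge0//; ring.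
  rewrite ge0_integralD//; last 4 first.
  - by move=> z _; rewrite lee_fin sqr_ge0.
  - apply: measurable_funTS; apply/measurable_EFinP; apply: measurable_funX.
    exact: measurable_funB.
  - by move=> z _; rewrite -EFinM lee_fin mulr_ge0// mulr_ge0.
  - apply: measurable_funTS; apply: emeasurable_funM => //.
    exact: (measurableT_comp mc (pair1_measurable v)).
  apply: leeD => //.
  have mcv : measurable_fun setT (fun z => (c (v, z))%:E).
    exact: (measurableT_comp mc (pair1_measurable v)).
  rewrite ge0_integralZl//; last 2 first.
  - exact: measurable_funTS.
  - by move=> z _; rewrite lee_fin mulr_ge0.
  rewrite lee_wpmul2l//; apply: ge0_subset_integral => //.
  by move=> z _; rewrite lee_fin mulr_ge0.
(* [c (v, z)] is w(z) w(z + v) *)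
have cross : \int[nu]_v \int[tx]_z (c (v, z))%:E <= E%:E * tx [set z | (0 < w z)%R].
  rewrite [leLHS](fubini_tonelli (m1 := nu) (m2 := tx) (EFin \o c))//=.
  pose I t := \int[nu]_x (w (t, x))%:E.
  have mEw : measurable_fun setT (EFin \o w) by exact/measurable_EFinP.
  have Ew0 z : 0 <= (EFin \o w) z by rewrite lee_fin.
  have mI : measurable_fun setT I.
    exact: (measurable_fun_fubini_tonelli_F (m2 := nu) _ mEw Ew0).
  have I0 t : 0 <= I t by apply: integral_ge0 => x _; rewrite lee_fin.
  have mwt t : measurable_fun setT (fun x => (w (t, x))%:E).
    exact: (measurableT_comp mEw (pair1_measurable t)).
  have mA : measurable ([set z | (0 < w z)%R] : set spacetime).
    rewrite (_ : [set z | _] = w @^-1` `]0%R, +oo[%classic); last first.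
      by apply/seteqP; split => z /=; rewrite in_itv/= andbT.
    by rewrite -[X in measurable X]setTI; exact: mw.
  rewrite (eq_integral (fun z => (w z)%:E * I z.1)); last first.
    move=> -[t x] _; under eq_integral do rewrite /c/= EFinM.
    rewrite ge0_integralZl//=; last 3 first.
    - exact: (measurableT_comp mEw (measurableT_comp msh (pair2_measurable (t, x)))).
    - by move=> v _; rewrite lee_fin.
    - by rewrite lee_fin.
    congr (_ * _); rewrite /I.
    rewrite -[RHS](ge0_integral_measure_preserving (measurable_shift_rV x)
      (@lebesgue_rV_shift R d x) (mwt t)); last by move=> v; rewrite lee_fin.
    by apply: eq_integral => v _; rewrite /sh /xshift/= addrC.
  have mwI : measurable_fun setT (fun z : spacetime => (w z)%:E * I z.1).
    by apply: emeasurable_funM => //; exact: (measurableT_comp mI measurable_fst).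
  have wI0 (z : spacetime) : 0 <= (w z)%:E * I z.1 by rewrite mule_ge0// lee_fin.
  rewrite [leLHS](fubini_tonelli1 (m1 := mu) (m2 := nu) _ mwI wI0).
  rewrite /fubini_F /=.
  have sectE t : nu [set x | (0 < w (t, x))%R] = nu (xsection [set z | (0 < w z)%R] t).
    by congr (nu _); apply/seteqP; split => x; rewrite /xsection /= inE.
  have msec := measurable_fun_xsection nu mA.
  apply: (@le_trans _ _ (\int[mu]_t (E%:E * nu [set x | (0 < w (t, x))%R]))); last first.
    under eq_integral do rewrite sectE.
    by rewrite (ge0_integralZl mu measurableT msec)// lee_fin ltW.
  apply: ae_ge0_le_integral => //.
  - by move=> t _; apply: integral_ge0 => x _; rewrite mule_ge0// lee_fin.
  - exact: (measurable_fun_fubini_tonelli_F (m2 := nu) _ mwI wI0).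
  - by move=> t _; rewrite mule_ge0// lee_fin ltW.
  - by under eq_fun do rewrite sectE; exact: emeasurable_funM.
  - apply: filterS H2 => t Ht _.
    rewrite ge0_integralZr//; last by move=> x _; rewrite lee_fin.
    apply: integral_sqr_le_support => //.
    exact: (measurableT_comp mw (pair1_measurable t)).
have mK := measurable_cube eta.
have iK : \int[nu]_(v in cube eta) L <=
    \int[nu]_(v in cube eta) (((d%:R * eta) ^+ 2 * E)%:E +
    2%:E * \int[tx]_z (c (v, z))%:E).
  apply: ge0_le_integral => //.
  - by move=> v _; apply: integral_ge0 => z _; rewrite lee_fin sqr_ge0.
  - by apply: measurable_funTS; apply: emeasurable_funD => //; exact: emeasurable_funM.
have L0 : 0 <= L by apply: integral_ge0 => z _; rewrite lee_fin sqr_ge0.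
rewrite integral_cst// in iK; rewrite muleC -lebesgue_rV_cube//.
apply: (le_trans iK).
rewrite ge0_integralD//; last 3 first.
- by move=> v _; rewrite lee_fin mulr_ge0 ?sqr_ge0// ltW.
- by move=> v _; rewrite mule_ge0//; apply: integral_ge0 => z _; exact: (c0 (v, z)).
- by apply: measurable_funTS; exact: emeasurable_funM.
rewrite integral_cst// muleC leeD2l//.
rewrite ge0_integralZl//; last 2 first.
- exact: measurable_funTS.
- by move=> v _; apply: integral_ge0 => z _; exact: (c0 (v, z)).
rewrite lee_wpmul2l//; apply: le_trans cross.
apply: ge0_subset_integral => //.
by move=> v _; apply: integral_ge0 => z _; exact: (c0 (v, z)).
Qed.

End nash.

(** * One step of the iteration *)

Section step.
Context {R : realType} {d : nat}.
Local Notation spacetime := (measurableTypeR R * 'rV[R]_d)%type.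
Local Notation tx := (@lebesgue_tx R d).
Local Notation mu := (@lebesgue_measure R).
Local Notation nu := (lebesgue_rV R d).

Lemma pos_part_ge0 (f : spacetime -> R) z : 0 <= pos_part f z.
Proof. by rewrite /pos_part le_max lexx orbT. Qed.

Lemma measurable_pos_part (D : set spacetime) (u : spacetime -> R) k :
  measurable_fun D u -> measurable_fun D (pos_part (fun z => u z - k)).
Proof.
move=> mu'; apply: measurable_maxr => //.
by apply: measurable_funB.
Qed.

Lemma le_pos_part (u : spacetime -> R) k k' z : k <= k' ->
  pos_part (fun z => u z - k') z <= pos_part (fun z => u z - k) z.
Proof.
move=> kk; rewrite /pos_part ge_max le_max lerB//= le_max lexx orbT.
by [].
Qed.

(** Where the truncation at the higher level is positive, the one at the lower level
is at least the gap. Both the Chebyshev bound of the measure of {w > 0} and the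
absorption of the source term rest on this. *)
Lemma pos_part_gap (u : spacetime -> R) k k' z : 0 < pos_part (fun z => u z - k') z ->
  k' - k <= pos_part (fun z => u z - k) z.
Proof. by rewrite /pos_part lt_max ltxx orbF le_max => h; apply/orP; left; lra. Qed.

Lemma subset_pcyl (X0 : spacetime) r r' : 0 < r <= r' -> pcyl X0 r `<=` pcyl X0 r'.
Proof.
move=> /andP[r0 rr] [t x] [/= tt xr]; have r2 : r ^+ 2 <= r' ^+ 2.
  by rewrite ler_pXn2r// nnegrE; [exact: ltW|rewrite (le_trans (ltW r0))].
split => /=; last exact: lt_le_trans xr rr.
by move: tt; rewrite !in_itv/= => /andP[ta ->]; rewrite andbT; lra.
Qed.

Lemma measurable_ocyl t1 t2 (x0 : 'rV[R]_d) r :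
  measurable (ocyl t1 t2 x0 r : set spacetime).
Proof.
rewrite (_ : ocyl t1 t2 x0 r = `]t1, t2[%classic `*` eball x0 r).
  by apply: measurableX; [exact: measurable_itv|exact: measurable_eball].
by apply/seteqP; split => -[t x]; rewrite /ocyl /eball /= in_itv/= => /andP.
Qed.

Local Open Scope ereal_scope.

(** The energy inequality between r2 and r3 bounds the slices of w^2 and its gradient
by E; [translation_estimate] between r1 and r2 then provides the hypotheses of
[nash] for w extended by zero outside of the cylinder of radius r2. *)
Lemma de_giorgi_step (C a b : R) (y : 'rV[R]_d) (l : R) (S u : spacetime -> R)
    (X0 : spacetime) (r1 r2 r3 k k' s eta A : R) :
  let Q := cylinder a b y l in
  let E := (C * (((r3 - r2) ^+ 2)^-1 + (r2 ^+ 2)^-1) * A + C * (s * (A / (k' - k))))%R in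
  pDG C a b y l S u -> measurable_fun Q S -> (1 <= C)%R ->
  pcyl X0 r3 `<=` Q -> (0 < r1)%R -> (r1 < r2)%R -> (r2 < r3)%R -> (k < k')%R ->
  (0 <= s)%R -> {ae tx, forall z, pcyl X0 r3 z -> (`|S z| <= s)%R} ->
  (0 < A)%R ->
  \int[tx]_(z in pcyl X0 r3) (pos_part (fun z => u z - k)%R z ^+ 2)%:E <= A%:E ->
  (0 < eta)%R -> (d%:R * eta <= r2 - r1)%R ->
  (eta ^+ d)%:E * \int[tx]_(z in pcyl X0 r1) (pos_part (fun z => u z - k')%R z ^+ 2)%:E
   <= (eta ^+ d * ((d%:R * eta) ^+ 2 * E) + 2 * (E * (A / (k' - k) ^+ 2)))%:E.
Proof.
move=> Q E [mu' _ _ dg] mS C1 PQ r10 r12 r23 kk s0 Ss A0 WA eta0 etar.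
have C0 : (0 < C)%R by exact: lt_le_trans C1.
have del0 : (0 < k' - k)%R by rewrite subr_gt0.
have r20 : (0 < r2)%R by exact: lt_trans r12.
have r30 : (0 < r3)%R by exact: lt_trans r23.
set w := pos_part (fun z => u z - k')%R; set W := pos_part (fun z => u z - k)%R in WA *.
have [h wg en] := dg k'.
have {en} en := en X0 r2 r3.
have mP r : measurable (pcyl X0 r) by exact: measurable_cylinder.
have mQ : measurable Q by exact: measurable_cylinder.
have mQw : measurable_fun Q w by exact: measurable_pos_part.
have mQW : measurable_fun Q W by exact: measurable_pos_part.
have P2P3 : pcyl X0 r2 `<=` pcyl X0 r3 by apply: subset_pcyl; rewrite r20 ltW.
have P2Q : pcyl X0 r2 `<=` Q by exact: subset_trans PQ.
have mw3 : measurable_fun (pcyl X0 r3) w by exact: measurable_funS mQw.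
have mW3 : measurable_fun (pcyl X0 r3) W by exact: measurable_funS mQW.
have mw2 : measurable_fun (pcyl X0 r2) w by exact: measurable_funS mQw.
have mS3 : measurable_fun (pcyl X0 r3) S by exact: measurable_funS mS.
have w0 z : (0 <= w z)%R by exact: pos_part_ge0.
have W0 z : (0 <= W z)%R by exact: pos_part_ge0.
have wW z : (w z <= W z)%R by apply: le_pos_part; exact: ltW.
have X0Q : Q X0.
  apply: PQ; split; first by rewrite /= in_itv/= lexx andbT ltrBlDr ltrDl exprn_gt0.
  rewrite /eball /= subrr /enorm big1 ?sqrtr0// => i _.
  by rewrite mxE expr0n.
have w2A : \int[tx]_(z in pcyl X0 r3) (w z ^+ 2)%:E <= A%:E.
  apply: le_trans WA; apply: ge0_le_integral => //.
  - by move=> z _; rewrite lee_fin sqr_ge0.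
  - by apply/measurable_EFinP; exact: measurable_funX.
  - by apply/measurable_EFinP; exact: measurable_funX.
  - by move=> z _; rewrite lee_fin ler_pXn2r// nnegrE.
have SwA : \int[tx]_(z in pcyl X0 r3) (`|S z| * w z)%:E <= (s * (A / (k' - k)))%:E.
  apply: (@le_trans _ _ (\int[tx]_(z in pcyl X0 r3) ((s / (k' - k))%:E * (W z ^+ 2)%:E))).
    apply: ae_ge0_le_integral => //.
    - by move=> z _; rewrite lee_fin mulr_ge0.
    - by apply/measurable_EFinP; apply: measurable_funM => //; exact: measurableT_comp.
    - by move=> z _; rewrite -EFinM lee_fin mulr_ge0 ?sqr_ge0// divr_ge0// ltW.
    - apply: emeasurable_funM => //; apply/measurable_EFinP; exact: measurable_funX.
    apply: filterS Ss => z Sz Pz; rewrite -EFinM lee_fin -mulrA.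
    apply: ler_pM => //; first exact: Sz.
    have [wz|wz] := ltP 0%R (w z); last first.
      by rewrite (le_trans wz)// mulr_ge0 ?sqr_ge0// invr_ge0 ltW.
    rewrite mulrC ler_pdivlMr// expr2 ler_pM// ?(ltW del0)//.
    exact: (pos_part_gap (u := u) k wz).
  rewrite ge0_integralZl//; last 3 first.
  - by apply/measurable_EFinP; exact: measurable_funX.
  - by move=> z _; rewrite lee_fin sqr_ge0.
  - by rewrite lee_fin divr_ge0// ltW.
  rewrite (_ : (s * (A / (k' - k)))%R = (s / (k' - k) * A)%R); last by ring.
  rewrite [leRHS]EFinM; apply: lee_wpmul2l => //.
  by rewrite lee_fin divr_ge0// ltW.
have E0 : (0 < E)%R.
  rewrite /E ltr_wpDr//; first by rewrite mulr_ge0 ?(ltW C0)// mulr_ge0// divr_ge0// ltW.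
  rewrite mulr_gt0// mulr_gt0// ltr_wpDr//; first by rewrite invr_ge0 sqr_ge0.
  by rewrite invr_gt0 exprn_gt0// subr_gt0.
have {}en : ess_sup mu ((fun t => \int[nu]_(x in eball X0.2 r2) (w (t, x) ^+ 2)%:E)
       \_ `](X0.1 - r2 ^+ 2)%R, X0.1]) +
    \int[tx]_(z in pcyl X0 r2) (enorm (h z) ^+ 2)%:E <= E%:E.
  apply: (le_trans (en X0Q _ PQ)); first by rewrite r20.
  rewrite /E EFinD; apply: leeD.
    rewrite [in leRHS]EFinM; apply: lee_wpmul2l => //.
    by rewrite lee_fin mulr_ge0 ?(ltW C0)// addr_ge0// invr_ge0 sqr_ge0.
  by rewrite [in leRHS]EFinM; apply: lee_wpmul2l => //; rewrite lee_fin ltW.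
have muT : 0 < mu [set: R].
  have e := @lebesgue_measure_itv R `]-oo, +oo[; rewrite set_itvNyy /= in e.
  by rewrite [ltRHS]e addye.
have ess0 : 0 <= ess_sup mu ((fun t => \int[nu]_(x in eball X0.2 r2) (w (t, x) ^+ 2)%:E)
       \_ `](X0.1 - r2 ^+ 2)%R, X0.1]).
  apply: ess_sup_gee => //; apply: nearW => t; rewrite patchE; case: ifPn => // _.
  by apply: integral_ge0 => x _; rewrite lee_fin sqr_ge0.
have hE : \int[tx]_(z in pcyl X0 r2) (enorm (h z) ^+ 2)%:E <= E%:E.
  by apply: le_trans en; rewrite leeDr.
have essE : {ae mu, forall t, ((fun t => \int[nu]_(x in eball X0.2 r2) (w (t, x) ^+ 2)%:E)
       \_ `](X0.1 - r2 ^+ 2)%R, X0.1]) t <= E%:E}.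
  apply/ess_supP; apply: le_trans en; rewrite leeDl//.
  by apply: integral_ge0 => z _; rewrite lee_fin sqr_ge0.
pose wt : spacetime -> R := w \_ (pcyl X0 r2).
have mwt : measurable_fun setT wt by apply/(measurable_restrictT _ (mP r2)).
have wt0 z : (0 <= wt z)%R by rewrite /wt patchE; case: ifPn.
pose P1 : set spacetime := ocyl (X0.1 - r1 ^+ 2) X0.1 X0.2 r1.
have mP1 : measurable P1 by exact: measurable_ocyl.
(* the weak gradient is only tested on the interior of the cylinder *)
have P1E : \int[tx]_(z in pcyl X0 r1) (w z ^+ 2)%:E = \int[tx]_(z in P1) (wt z ^+ 2)%:E.
  rewrite [LHS]integral_cylinder_ocyl; last 2 first.
  - by apply/measurable_EFinP; apply: measurable_funX; apply: measurable_funS mw2 => //;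
      apply: subset_pcyl; rewrite r10 ltW.
  - by move=> z _; rewrite lee_fin sqr_ge0.
  apply: eq_integral => z /set_mem; rewrite /P1 /ocyl /= => /andP[/andP[ta tb] xl].
  rewrite /wt patchE mem_set//; apply: (@subset_pcyl X0 r1); first by rewrite r10 ltW.
  by split => //=; rewrite in_itv/= ta ltW.
rewrite P1E.
have w2A2 : \int[tx]_(z in pcyl X0 r2) (w z ^+ 2)%:E < +oo.
  apply: (@le_lt_trans _ _ A%:E); last exact: ltry.
  apply: le_trans w2A; apply: ge0_subset_integral => //.
  - by apply/measurable_EFinP; exact: measurable_funX.
  - by move=> z _; rewrite lee_fin sqr_ge0.
have H1 v : (enorm v <= d%:R * eta)%R ->
    \int[tx]_(z in P1) ((wt (xshift v z) - wt z) ^+ 2)%:E <= ((d%:R * eta) ^+ 2 * E)%:E.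
  move=> vd.
  have := @translation_estimate R d a b y l w h X0 r1 r2 v.
  move=> /(_ _ P2Q wg mQw w2A2) H; apply: (le_trans (H _ _ _)).
  - by rewrite r10.
  - exact: le_lt_trans hE (ltry _).
  - exact: le_trans vd etar.
  - rewrite [leRHS]EFinM; apply: lee_pmul => //.
    + by rewrite lee_fin sqr_ge0.
    + by apply: integral_ge0 => z _; rewrite lee_fin sqr_ge0.
    + by rewrite lee_fin ler_pXn2r// nnegrE ?enorm_ge0// (le_trans (enorm_ge0 v)).
have H2 : {ae mu, forall t, \int[nu]_x (wt (t, x) ^+ 2)%:E <= E%:E}.
  apply: (@filterS _ _ (ae_filter_ringOfSetsType mu) _ _ _ essE) => t; apply: le_trans.
  rewrite patchE; case: ifPn => tJ.
    rewrite [leRHS]integral_mkcond le_eqVlt; apply/orP; left; apply/eqP.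
    apply: eq_integral => x _; rewrite /wt !patchE.
    have -> : ((t, x) \in pcyl X0 r2) = (x \in eball X0.2 r2).
      apply/idP/idP => /set_mem; first by move=> [_ /= ?]; exact: mem_set.
      by move=> xb; apply/mem_set; split => //=; exact: set_mem.
    by case: ifPn => // _; rewrite expr0n.
  rewrite integral0_eq// => x _; rewrite /wt patchE.
  case: ifPn => [/set_mem[/= tJ' _]|_]; last by rewrite expr0n.
  by rewrite mem_set in tJ.
have H3 : tx [set z | (0 < wt z)%R] <= (A / (k' - k) ^+ 2)%:E.
  set B := [set z | _].
  have mB : measurable B.
    rewrite (_ : B = wt @^-1` `]0%R, +oo[%classic); last first.
      by apply/seteqP; split => z /=; rewrite in_itv/= andbT.
    by rewrite -[X in measurable X]setTI; exact: mwt.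
  have BP : B `<=` pcyl X0 r3.
    move=> z; rewrite /B /= /wt patchE; case: ifPn => [/set_mem/P2P3//|_].
    by rewrite ltxx.
  have del2 : (0 < (k' - k) ^+ 2)%R by exact: exprn_gt0.
  have dB : ((k' - k) ^+ 2)%:E * tx B <= A%:E.
    rewrite -integral_cst//; apply: le_trans WA.
    apply: (@le_trans _ _ (\int[tx]_(z in B) (W z ^+ 2)%:E)).
      apply: ge0_le_integral => //.
      - by move=> z _; rewrite lee_fin sqr_ge0.
      - apply/measurable_EFinP; apply: measurable_funX.
        exact: measurable_funS mW3.
      - move=> z; rewrite /B /= /wt patchE; case: ifPn => [_ wz|_]; last by rewrite ltxx.
        rewrite lee_fin ler_pXn2r// ?nnegrE ?(ltW del0)//.
        exact: (pos_part_gap (u := u) k wz).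
    apply: ge0_subset_integral => //.
      by apply/measurable_EFinP; exact: measurable_funX.
    by move=> z _; rewrite lee_fin sqr_ge0.
  rewrite -(@lee_pmul2l _ ((k' - k) ^+ 2)%:E) ?lte_fin//.
  by rewrite -EFinM mulrC divfK ?gt_eqF.
have := nash mwt wt0 mP1 eta0 E0 H1 H2; move/le_trans; apply.
rewrite [leRHS]EFinD; apply: leeD; first by rewrite EFinM.
rewrite [leRHS]EFinM lee_wpmul2l// [leRHS]EFinM lee_wpmul2l//.
by rewrite lee_fin ltW.
Qed.

End step.

(** * The recursion *)

Section iteration.
Context {R : realType} (d : nat).
Hypothesis d1 : (1 <= d)%N.

(** The decay rate 2^-(d + 4) of the recursion. At step n the quadratic term carries
the factors 2^(2n) from the gap between the radii, 2^(2n) from the gap between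
the levels and 2^(dn) from the size of the cube, which this rate compensates. *)
Definition ratio : R := 2^-1 ^+ (d + 4).
(** Small enough that the vectors of the cube of side cube_scale * 2^-n / sqrt L are
shorter than the gap between the radii ([cube_scale_dim_le]) and that the gradient term contributes
at most half of the decay ([cube_scale_energy]). *)
Definition cube_scale (C : R) : R := ratio / (8 * d%:R * C).
(** Large enough that the quadratic term contributes the other half. *)
Definition level_cst (C : R) : R := 512 * C / (cube_scale C ^+ d * ratio).

Let dR1 : 1 <= d%:R :> R. Proof. by rewrite ler1n. Qed.
Let dR0 : 0 < d%:R :> R. Proof. exact: lt_le_trans dR1. Qed.

Lemma ratio_gt0 : 0 < ratio. Proof. by rewrite exprn_gt0// invr_gt0. Qed.

Lemma ratio_le1 : ratio <= 1.
Proof. by rewrite exprn_ile1 ?invr_ge0// invf_le1// ler1n. Qed.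

Variable C : R.
Hypothesis C1 : 1 <= C.
Let C0 : 0 < C. Proof. exact: lt_le_trans C1. Qed.
Let c := cube_scale C.

Lemma cube_scale_gt0 : 0 < c.
Proof. by rewrite divr_gt0 ?ratio_gt0// !mulr_gt0. Qed.

Lemma cube_scale_dim : d%:R * c = ratio / (8 * C).
Proof. by rewrite /c /cube_scale; field; rewrite !gt_eqF. Qed.

Lemma cube_scale_dim_le : d%:R * c <= 4^-1.
Proof.
rewrite cube_scale_dim ler_pdivrMr ?mulr_gt0//.
by apply: (le_trans ratio_le1); have := C1; lra.
Qed.

Lemma cube_scale_energy : 64 * (d%:R * c) ^+ 2 * C <= ratio.
Proof.
rewrite cube_scale_dim (_ : _ * C = ratio * (ratio / C)); last first.
  by field; rewrite gt_eqF.
rewrite ger_pMr ?ratio_gt0// ler_pdivrMr// mul1r.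
exact: le_trans ratio_le1 C1.
Qed.

Lemma cube_scale_le1 : c <= 1.
Proof.
have := cube_scale_dim_le; have := cube_scale_gt0 => c0 dc.
have : c <= d%:R * c by rewrite ler_peMl// ltW.
by lra.
Qed.

Lemma level_cst_ge1 : 1 <= level_cst C.
Proof.
rewrite /level_cst ler_pdivlMr ?mulr_gt0 ?exprn_gt0 ?ratio_gt0 ?cube_scale_gt0// mul1r.
apply: (@le_trans _ _ 1); last by have := C1; lra.
have c0 := ltW cube_scale_gt0; have c1 := cube_scale_le1.
have cd1 : c ^+ d <= 1 by rewrite exprn_ile1.
apply: mulr_ile1 => //; [exact: exprn_ge0|exact: ltW ratio_gt0|exact: ratio_le1].
Qed.

(** The right-hand side of [de_giorgi_step] at step n, with q = 2^-n, is at most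
[ratio] times the current bound A. First E <= 32 C L A / q^2; half of [ratio * A]
then pays for the term with the gradient, half for the quadratic one. *)
Lemma recursion_step (sL g r r2 r3 q kappa s alpha : R) :
  let L := sL ^+ 2 in
  let A := alpha * q ^+ (d + 4) in
  let delta := kappa * q / 2 in
  let eta := c * q / sL in
  let E := C * (((r3 - r2) ^+ 2)^-1 + (r2 ^+ 2)^-1) * A + C * (s * (A / delta)) in
  0 < q <= 1 -> 0 < r -> 0 < g -> r <= r2 -> r3 - r2 = g * q / 4 ->
  1 <= sL -> 1 + (r ^+ 2)^-1 + (g ^+ 2)^-1 <= L -> 0 <= s <= kappa -> 0 < kappa -> 0 < alpha ->
  level_cst C * sL ^+ (d + 2) * alpha <= kappa ^+ 2 ->
  eta ^+ d * ((d%:R * eta) ^+ 2 * E) + 2 * (E * (A / delta ^+ 2)) <=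
  eta ^+ d * (ratio * A).
Proof.
move=> L A delta eta E /andP[q0 q1] r0 g0 rr2 r32 sL1 hL /andP[s0 sk] k0 al0 hk.
have sL0 : 0 < sL by exact: lt_le_trans sL1.
have L0 : 0 < L by exact: exprn_gt0.
have A0 : 0 < A by rewrite mulr_gt0// exprn_gt0.
have del0 : 0 < delta by rewrite divr_gt0// mulr_gt0.
have c0 := cube_scale_gt0.
have eta0 : 0 < eta by rewrite divr_gt0// mulr_gt0.
have q20 : 0 < q ^+ 2 by exact: exprn_gt0.
have q21 : q ^+ 2 <= 1 by rewrite exprn_ile1// ltW.
have r20 : 0 < r2 by exact: lt_le_trans rr2.
have th0 := ratio_gt0.
have gi0 : 0 < (g ^+ 2)^-1 by rewrite invr_gt0 exprn_gt0.
have ri0 : 0 < (r ^+ 2)^-1 by rewrite invr_gt0 exprn_gt0.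
have iq1 : 1 <= (q ^+ 2)^-1 by rewrite invf_ge1.
have EE : E <= 32 * C * L * A / q ^+ 2.
  have e1 : ((r3 - r2) ^+ 2)^-1 = 16 * (g ^+ 2)^-1 * (q ^+ 2)^-1.
    by rewrite r32; field; rewrite !gt_eqF.
  have e2 : (r2 ^+ 2)^-1 <= (r ^+ 2)^-1 * (q ^+ 2)^-1.
    apply: (@le_trans _ _ (r ^+ 2)^-1); last by rewrite ler_peMr// ltW.
    by rewrite lef_pV2 ?posrE ?exprn_gt0// ler_pXn2r// nnegrE ltW.
  have e3 : s * (A / delta) <= 2 * A * (q ^+ 2)^-1.
    apply: (@le_trans _ _ (kappa * (A / delta))).
      by rewrite ler_wpM2r// divr_ge0// ltW.
    rewrite (_ : kappa * _ = 2 * A * q^-1); last first.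
      by rewrite /delta; field; rewrite !gt_eqF.
    have tA0 : 0 <= 2 * A by apply: mulr_ge0 => //; exact: ltW.
    apply: (ler_wpM2l tA0).
    by rewrite lef_pV2 ?posrE// expr2 ger_pMl.
  have h1 : ((r3 - r2) ^+ 2)^-1 + (r2 ^+ 2)^-1 <= 16 * L * (q ^+ 2)^-1.
    rewrite e1; move: e2 hL gi0 ri0 iq1.
    move: (r2 ^+ 2)^-1 (r ^+ 2)^-1 (g ^+ 2)^-1 (q ^+ 2)^-1 => x y z w e2 hL' z0 y0 w1.
    have P : 0 <= (16 * L - (16 * z + y)) * w by apply: mulr_ge0; lra.
    by lra.
  have h2 : s * (A / delta) <= 16 * L * A * (q ^+ 2)^-1.
    apply: (le_trans e3); rewrite ler_wpM2r ?invr_ge0 ?(ltW q20)// ler_wpM2r ?(ltW A0)//.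
    by lra.
  rewrite /E (_ : 32 * C * L * A / q ^+ 2 =
     C * (16 * L * (q ^+ 2)^-1) * A + C * (16 * L * A * (q ^+ 2)^-1)); last by ring.
  apply: lerD; last by rewrite ler_wpM2l// ltW.
  by rewrite ler_wpM2r ?(ltW A0)// ler_wpM2l ?(ltW C0).
have e0 : 0 < eta ^+ d by exact: exprn_gt0.
rewrite (_ : eta ^+ d * (ratio * A) = eta ^+ d * (ratio * A / 2) + eta ^+ d * (ratio * A / 2)); last by field.
apply: lerD.
  rewrite ler_pM2l//.
  apply: (@le_trans _ _ ((d%:R * eta) ^+ 2 * (32 * C * L * A / q ^+ 2))).
    by rewrite ler_wpM2l ?sqr_ge0.
  rewrite (_ : _ * _ = 64 * (d%:R * c) ^+ 2 * C * (A / 2)); last first.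
    by rewrite /eta /L; field; rewrite !gt_eqF.
  by rewrite -[leRHS]mulrA ler_wpM2r ?divr_ge0 ?(ltW A0)// cube_scale_energy.
apply: (@le_trans _ _ (2 * ((32 * C * L * A / q ^+ 2) * (A / delta ^+ 2)))).
  by rewrite ler_wpM2l// ler_wpM2r// divr_ge0 ?(ltW A0)// sqr_ge0.
rewrite (_ : 2 * _ = (256 * C * L * alpha / kappa ^+ 2) * (q ^+ d * A)); last first.
  by rewrite /delta /A exprD; field; rewrite !gt_eqF.
rewrite (_ : eta ^+ d * _ = (c ^+ d * ratio / (2 * sL ^+ d)) * (q ^+ d * A)); last first.
  rewrite /eta expr_div_n exprMn; field.
  by rewrite gt_eqF// exprn_gt0.
have qA0 : 0 <= q ^+ d * A by apply: mulr_ge0; [exact/exprn_ge0/ltW|exact: ltW].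
apply: (ler_wpM2r qA0).
rewrite ler_pdivrMr ?exprn_gt0//.
have cd0 : 0 < c ^+ d by exact: exprn_gt0.
have sd0 : 0 < sL ^+ d by exact: exprn_gt0.
apply: (@le_trans _ _ (c ^+ d * ratio / (2 * sL ^+ d) * (level_cst C * sL ^+ (d + 2) * alpha))).
  rewrite /level_cst -/c /L exprD le_eqVlt; apply/orP; left; apply/eqP.
  by field; rewrite !gt_eqF.
by rewrite ler_wpM2l// divr_ge0 ?mulr_ge0 ?(ltW cd0) ?(ltW th0)// (ltW sd0).
Qed.

End iteration.

Section de_giorgi.
Context {R : realType} {d : nat}.
Local Notation spacetime := (measurableTypeR R * 'rV[R]_d)%type.
Local Notation tx := (@lebesgue_tx R d).
Local Open Scope ereal_scope.

Lemma half_expn_small (al x : R) : (0 < x)%R -> exists n, (al * 2^-1 ^+ n < x)%R.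
Proof.
move=> x0; have [al0|al0] := leP al 0%R.
  by exists 0%N; rewrite expr0 mulr1 (le_lt_trans al0).
exists (Num.truncn (al / x)).+1; set n := (Num.truncn (al / x)%R).+1.
have h : (al / x < n%:R)%R by exact: truncnS_gt.
have h2 : (n%:R < 2 ^+ n :> R)%R by rewrite -natrX ltr_nat ltn_expl.
rewrite exprVn ltr_pdivrMr ?exprn_gt0//.
rewrite ltr_pdivrMr// in h; apply: (lt_trans h).
by rewrite mulrC ltr_pM2l.
Qed.

(** The radii are r + (rho - r) 2^-n and the levels kappa (1 - 2^-n). The integrals of
(u - kappa)_+^2 over the limit cylinder are below alpha 2^-n for all n. *)
Lemma de_giorgi_iteration (C a b : R) (y : 'rV[R]_d) (l : R) (S u : spacetime -> R)
    (X0 : spacetime) (r rho s kappa alpha : R) :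
  let Q := cylinder a b y l in
  let L := (1 + (r ^+ 2)^-1 + ((rho - r) ^+ 2)^-1)%R in
  (1 <= d)%N -> (1 <= C)%R -> pDG C a b y l S u -> measurable_fun Q S ->
  pcyl X0 rho `<=` Q -> (0 < r < rho)%R -> (0 <= s <= kappa)%R ->
  {ae tx, forall z, pcyl X0 rho z -> (`|S z| <= s)%R} ->
  (0 < alpha)%R -> (0 < kappa)%R ->
  \int[tx]_(z in pcyl X0 rho) (pos_part u z ^+ 2)%:E <= alpha%:E ->
  (level_cst d C * Num.sqrt L ^+ (d + 2) * alpha <= kappa ^+ 2)%R ->
  {ae tx, forall z, pcyl X0 r z -> (u z <= kappa)%R}.
Proof.
move=> Q L d1 C1 pdg mS PQ /andP[r0 rrho] /andP[s0 sk] Ss al0 k0 uA hk.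
set g := (rho - r)%R; have g0 : (0 < g)%R by rewrite subr_gt0.
pose q n : R := (2^-1 ^+ n)%R.
have q0 n : (0 < q n)%R by rewrite exprn_gt0// invr_gt0.
have q1 n : (q n <= 1)%R by rewrite exprn_ile1 ?invr_ge0// invf_le1// ler1n.
have qS n : q n.+1 = (q n / 2)%R by rewrite /q exprS mulrC.
have C0 : (0 < C)%R by exact: lt_le_trans C1.
have ir0 : (0 < (r ^+ 2)^-1)%R by rewrite invr_gt0 exprn_gt0.
have ig0 : (0 < (g ^+ 2)^-1)%R by rewrite invr_gt0 exprn_gt0.
have L1 : (1 <= L)%R by rewrite /L -addrA lerDl addr_ge0// ltW.
set sL := Num.sqrt L in hk.
have sLL : (sL ^+ 2 = L)%R by rewrite sqr_sqrtr// (le_trans ler01).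
have sL1 : (1 <= sL)%R by rewrite -sqrtr1 ler_sqrt// (le_trans ler01).
have sL0 : (0 < sL)%R by exact: lt_le_trans sL1.
have gsL : (g^-1 <= sL)%R.
  rewrite -(@ler_pXn2r _ 2)// ?nnegrE ?invr_ge0 ?(ltW g0) ?(ltW sL0)//.
  by rewrite sLL exprVn /L -/g; lra.
have c0 := cube_scale_gt0 d1 C1.
have rate n : \int[tx]_(z in pcyl X0 (r + g * q n)%R)
    (pos_part (fun z => u z - kappa * (1 - q n))%R z ^+ 2)%:E <=
    (alpha * q n ^+ (d + 4))%:E.
  elim: n => [|n IH].
    rewrite {2 3}/q expr0 expr1n mulr1 subrr mulr0.
    have -> : (r + g * q 0%N)%R = rho by rewrite /q expr0 /g; ring.
    rewrite (_ : (fun z => u z - 0)%R = u)//.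
    by apply/funext => z; rewrite subr0.
  set eta := (cube_scale d C * q n / sL)%R.
  have eta0 : (0 < eta)%R by rewrite divr_gt0// mulr_gt0.
  have gq0 : (0 < g * q n)%R by rewrite mulr_gt0.
  have A0 : (0 < alpha * q n ^+ (d + 4))%R by rewrite mulr_gt0// exprn_gt0.
  have dk : (kappa * (1 - q n.+1) - kappa * (1 - q n) = kappa * q n / 2)%R.
    by rewrite qS; field.
  have r1E : (r + g * q n.+1 = r + g * q n / 2)%R by rewrite qS mulrA.
  have sub : pcyl X0 (r + g * q n)%R `<=` pcyl X0 rho.
    apply: subset_pcyl; apply/andP; split; first by rewrite addr_gt0.
    have : (g * q n <= g)%R by rewrite ger_pMr.
    by rewrite /g; lra.
  have etar : (d%:R * eta <= r + g * q n * 3 / 4 - (r + g * q n.+1))%R.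
    rewrite r1E (_ : _ - _ = g * q n / 4)%R; last by field.
    rewrite /eta (_ : _ * _ = (d%:R * cube_scale d C) * (q n / sL))%R; last by ring.
    apply: (@le_trans _ _ (4^-1 * (q n / sL))%R).
      by rewrite ler_wpM2r ?cube_scale_dim_le// divr_ge0 ?ltW.
    rewrite (_ : g * q n / 4 = 4^-1 * (q n * g))%R; last by ring.
    rewrite ler_wpM2l ?invr_ge0// ler_wpM2l ?(ltW (q0 n))//.
    by rewrite -[leRHS]invrK lef_pV2 ?posrE ?invr_gt0.
  have Ss' : {ae tx, forall z, pcyl X0 (r + g * q n)%R z -> (`|S z| <= s)%R}.
    by move: Ss; apply: filterS => z Sz /sub; exact: Sz.
  (* the intermediate radius is the midpoint of two consecutive radii *)
  have := @de_giorgi_step R d C a b y l S u X0 (r + g * q n.+1) (r + g * q n * 3 / 4)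
    (r + g * q n) (kappa * (1 - q n)) (kappa * (1 - q n.+1)) s eta
    (alpha * q n ^+ (d + 4)) pdg mS C1 (subset_trans sub PQ) _ _ _ _ s0 Ss' A0 IH eta0 etar.
  rewrite dk => H.
  have RS := @recursion_step R d d1 C C1 sL g r (r + g * q n * 3 / 4) (r + g * q n) (q n)
    kappa s alpha.
  rewrite -(@lee_pmul2l _ (eta ^+ d)%:E) ?lte_fin//; last by rewrite exprn_gt0.
  apply: (le_trans (H _ _ _ _)).
  - by rewrite addr_gt0// mulr_gt0.
  - by rewrite r1E; lra.
  - by lra.
  - by rewrite -subr_gt0 dk divr_gt0// mulr_gt0.
  rewrite -EFinM lee_fin.
  rewrite (_ : alpha * q n.+1 ^+ (d + 4) = ratio d * (alpha * q n ^+ (d + 4)))%R; last first.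
    by rewrite qS exprMn /ratio; ring.
  apply: RS => //.
  - by rewrite q0 q1.
  - by rewrite lerDl; lra.
  - by field.
  - by rewrite sLL.
  - by rewrite s0 sk.
set X := \int[tx]_(z in pcyl X0 r) (pos_part (fun z => u z - kappa)%R z ^+ 2)%:E.
have [mu' _ _ _] := pdg.
have mQ : measurable Q by exact: measurable_cylinder.
have mP r' : measurable (pcyl X0 r') by exact: measurable_cylinder.
have Pr : pcyl X0 r `<=` pcyl X0 rho by apply: subset_pcyl; rewrite r0 ltW.
have mfr k : measurable_fun (pcyl X0 rho) (pos_part (fun z => u z - k)%R).
  by apply: measurable_pos_part; exact: measurable_funS mu'.
have X0' : 0 <= X by apply: integral_ge0 => z _; rewrite lee_fin sqr_ge0.
have Xn n : X <= (alpha * q n)%:E.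
  have sub1 : pcyl X0 r `<=` pcyl X0 (r + g * q n)%R.
    by apply: subset_pcyl; rewrite r0 lerDl mulr_ge0 ?ltW.
  have sub2 : pcyl X0 (r + g * q n)%R `<=` pcyl X0 rho.
    apply: subset_pcyl; apply/andP; split; first by rewrite addr_gt0// mulr_gt0.
    have : (g * q n <= g)%R by rewrite ger_pMr.
    by rewrite /g; lra.
  apply: (@le_trans _ _ (alpha * q n ^+ (d + 4))%:E); last first.
    rewrite lee_fin ler_wpM2l ?(ltW al0)//.
    by rewrite addnC addSn exprS ger_pMr// exprn_ile1// ltW.
  apply: le_trans (rate n).
  apply: (@le_trans _ _ (\int[tx]_(z in pcyl X0 r)
      (pos_part (fun z => u z - kappa * (1 - q n))%R z ^+ 2)%:E)).
    apply: ge0_le_integral => //.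
    - by move=> z _; rewrite lee_fin sqr_ge0.
    - by apply/measurable_EFinP; apply: measurable_funX; exact: measurable_funS (mfr _).
    - by apply/measurable_EFinP; apply: measurable_funX; exact: measurable_funS (mfr _).
    - move=> z _; rewrite lee_fin ler_pXn2r// ?nnegrE ?pos_part_ge0//.
      by apply: le_pos_part; rewrite ger_pMr// gerBl ltW.
  apply: ge0_subset_integral => //.
    by apply/measurable_EFinP; apply: measurable_funX; exact: measurable_funS (mfr _).
  by move=> z _; rewrite lee_fin sqr_ge0.
have XE0 : X = 0.
  apply/eqP; rewrite eq_le X0' andbT leNgt; apply/negP => Xpos.
  have Xfin : X \is a fin_num.
    by rewrite ge0_fin_numE//; apply: (le_lt_trans (Xn 0%N)); exact: ltry.
  have xpos : (0 < fine X)%R by rewrite fine_gt0// Xpos ltey_eq Xfin.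
  have [n hn] := half_expn_small alpha xpos.
  have := Xn n; rewrite -(fineK Xfin) lee_fin => /(lt_le_trans hn).
  by rewrite ltxx.
have mf := measurable_funS (mP rho) Pr (mfr kappa).
have /(ae_eq_integral_abs tx (mP r)) : measurable_fun (pcyl X0 r)
    (fun z => (pos_part (fun z => u z - kappa)%R z ^+ 2)%:E).
  by apply/measurable_EFinP; exact: measurable_funX.
move=> [+ _].
have -> : \int[tx]_(z in pcyl X0 r) `|(pos_part (fun z => u z - kappa)%R z ^+ 2)%:E| = X.
  by apply: eq_integral => z _; rewrite gee0_abs// lee_fin sqr_ge0.
move=> /(_ XE0); apply: filterS => z /= H Pz; have := H Pz => -[/eqP].
rewrite sqrf_eq0 => /eqP wz.
have := le_refl (pos_part (fun z => u z - kappa)%R z).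
by rewrite {2}wz /pos_part ge_max => /andP[]; rewrite subr_le0.
Qed.

End de_giorgi.

(** * Local boundedness *)

Section Lnorm_on_lemmas.
Context {R : realType} {d : nat}.
Local Notation spacetime := (measurableTypeR R * 'rV[R]_d)%type.
Local Notation tx := (@lebesgue_tx R d).
Local Open Scope ereal_scope.

Lemma Lnorm_on_ge0 D p (f : spacetime -> R) : 0 <= Lnorm_on D p f.
Proof. exact: Lnorm_ge0. Qed.

Lemma integral_sqr_Lnorm_on (D : set spacetime) (f : spacetime -> R) (n2 : R) :
  Lnorm_on D 2%:E f = n2%:E ->
  \int[tx]_(z in D) (f z ^+ 2)%:E = (n2 ^+ 2)%:E.
Proof.
move=> fn2; have n20 : (0 <= n2)%R by rewrite -lee_fin -fn2 Lnorm_on_ge0.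
have h := @poweR_Lnorm _ _ _ tx (EFin \o (f \_ D)) 2%R.
rewrite -/(Lnorm_on D 2%:E f) fn2 in h.
rewrite poweR_EFin powR_mulrn// in h.
have two : (2 != 0 :> R)%R by rewrite pnatr_eq0.
rewrite (h two) [LHS]integral_mkcond. apply: eq_integral => z _.
rewrite -[RHS]/(poweR ((`|(f \_ D) z|)%R)%:E 2%R).
rewrite poweR_EFin powR_mulrn ?normr_ge0// real_normK ?num_real//.
by rewrite !patchE; case: ifPn => // _; rewrite expr0n.
Qed.

Lemma Lnorm_on_oo_ae (D : set spacetime) (f : spacetime -> R) (s : R) :
  0 < tx [set: spacetime] -> Lnorm_on D +oo f = s%:E ->
  {ae tx, forall z, D z -> (`|f z| <= s)%R}.
Proof.
move=> t0; rewrite /Lnorm_on unlock /= t0 => fs.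
have : ess_sup tx (abse \o (EFin \o (f \_ D))) <= s%:E by rewrite fs.
move=> /ess_supP; apply: filterS => z /= + Dz.
by rewrite patchE mem_set// lee_fin.
Qed.

Lemma Lnorm_on_oo_le (D : set spacetime) (f : spacetime -> R) (s : R) : (0 <= s)%R ->
  {ae tx, forall z, D z -> (`|f z| <= s)%R} -> Lnorm_on D +oo f <= s%:E.
Proof.
move=> s0 fs; rewrite /Lnorm_on unlock /=; case: ifPn => // _.
apply/ess_supP; move: fs; apply: filterS => z fz /=.
rewrite patchE; case: ifPn => [/set_mem/fz//|_].
by rewrite normr0 lee_fin.
Qed.

End Lnorm_on_lemmas.

(** The second term of alpha = n2^2 + e^2 / (K T) makes alpha positive also when n2 = 0;
its contribution is exactly e^2. *)
Lemma level_bound (R : realType) (K T P n2 s e : R) :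
  1 <= K -> 0 < T -> T <= P ^+ 2 -> 0 <= P -> 0 <= n2 -> 0 <= s -> 0 < e ->
  K * T * (n2 ^+ 2 + e ^+ 2 / (K * T)) <= (K * (P * n2 + s) + e) ^+ 2.
Proof.
move=> K1 T0 TP P0 n0 s0 e0.
have K0 : 0 < K by exact: lt_le_trans K1.
rewrite (_ : K * T * _ = K * T * n2 ^+ 2 + e ^+ 2); last first.
  by field; rewrite !gt_eqF.
have x0 : 0 <= K * (P * n2) by rewrite !mulr_ge0// ltW.
have y0 : e <= K * s + e by rewrite lerDr mulr_ge0// ltW.
have h1 : K * T * n2 ^+ 2 <= (K * (P * n2)) ^+ 2.
  rewrite !exprMn mulrA ler_wpM2r ?sqr_ge0// ler_pM ?(ltW K0) ?(ltW T0)//.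
  by rewrite expr2 ler_peMl// ltW.
have h2 : e ^+ 2 <= (K * s + e) ^+ 2.
  by rewrite ler_pXn2r// nnegrE ?(le_trans (ltW e0) y0)// ltW.
have h3 : 0 <= K * (P * n2) * (K * s + e).
  by rewrite mulr_ge0// (le_trans (ltW e0) y0).
rewrite (_ : K * (P * n2 + s) + e = K * (P * n2) + (K * s + e)); last by ring.
rewrite sqrrD; move: h1 h2 h3.
move: ((K * (P * n2)) ^+ 2) ((K * s + e) ^+ 2) (K * (P * n2) * (K * s + e)) => p q m.
by move: (K * T * n2 ^+ 2) (e ^+ 2) => p' q'; lra.
Qed.

Theorem proposition3p3p5 (R : realType) (d : nat) (CpDG : R)
    (d_ge1 : (1 <= d)%N) (CpDG_ge1 : 1 <= CpDG) :
  exists C : R, 1 <= C /\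
    forall (Y : measurableTypeR R * 'rV[R]_d) (l : R), 0 < l ->
    forall S u : measurableTypeR R * 'rV[R]_d -> R,
      in_Lp (pcyl Y l) +oo%E S ->
      pDG CpDG (Y.1 - l ^+ 2) Y.1 Y.2 l S u ->
    forall (X0 : measurableTypeR R * 'rV[R]_d) (r rho : R),
      pcyl X0 rho `<=` pcyl Y l -> 0 < r < rho ->
      let omega0 : R := (d%:R + 4) * (d%:R + 2) / 8 in
      (Lnorm_on (pcyl X0 r) +oo (pos_part u) <=
       C%:E * (((1 + (r ^+ 2)^-1 + ((rho - r) ^+ 2)^-1) `^ omega0)%:E
                 * Lnorm_on (pcyl X0 rho) 2%:E (pos_part u)
               + Lnorm_on (pcyl X0 rho) +oo S))%E.
Proof.
set K := level_cst d CpDG; have K1 : 1 <= K by exact: level_cst_ge1.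
have K0 : 0 < K by exact: lt_le_trans K1.
exists K; split; first exact: K1.
move=> Y l l0 S u [mS _] pdg X0 r rho PQ /andP[r0 rrho].
cbv zeta; set om : R := (d%:R + 4) * (d%:R + 2) / 8.
set L := (1 + _ + _ : R); set N2 := Lnorm_on _ 2%:E _; set Ns := Lnorm_on _ +oo S.
have ir0 : 0 < (r ^+ 2)^-1 by rewrite invr_gt0 exprn_gt0.
have ig0 : 0 < ((rho - r) ^+ 2)^-1 by rewrite invr_gt0 exprn_gt0// subr_gt0.
have L1 : 1 <= L by rewrite /L -addrA lerDl addr_ge0// ltW.
have L0 : 0 < L by exact: lt_le_trans L1.
have P0 : 0 < L `^ om by exact: powR_gt0.
have N20 : (0 <= N2)%E by exact: Lnorm_on_ge0.
have Ns0 : (0 <= Ns)%E by exact: Lnorm_on_ge0.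
have [N2y|N2y] := eqVneq N2 +oo%E.
  by rewrite N2y gt0_muley ?lte_fin// addye ?gt0_muley ?lte_fin ?leey// gt_eqF// (lt_le_trans _ Ns0).
have [Nsy|Nsy] := eqVneq Ns +oo%E.
  rewrite Nsy addey ?gt0_muley ?lte_fin ?leey//.
  by rewrite gt_eqF// (@lt_le_trans _ _ 0%E)// mule_ge0// lee_fin ltW.
have [t0|t0] := boolP (0 < @lebesgue_tx R d setT)%E; last first.
  rewrite {1}/Lnorm_on unlock (negbTE t0) mule_ge0 ?lee_fin ?(ltW K0)//.
  by rewrite adde_ge0// mule_ge0// lee_fin ltW.
have N2E : N2 = (fine N2)%:E by rewrite fineK// ge0_fin_numE// ltey.
have NsE : Ns = (fine Ns)%:E by rewrite fineK// ge0_fin_numE// ltey.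
set n2 := fine N2 in N2E; set s := fine Ns in NsE.
have n20 : 0 <= n2 by exact: fine_ge0.
have s0 : 0 <= s by exact: fine_ge0.
rewrite N2E NsE; apply/lee_addgt0Pr => e e0.
set T := Num.sqrt L ^+ (d + 2).
have T0 : 0 < T by rewrite exprn_gt0// sqrtr_gt0.
have TP : T <= (L `^ om) ^+ 2.
  rewrite /T -powR12_sqrt ?(ltW L0)// -!powR_mulrn ?powR_ge0// -!powRrM.
  rewrite ler_powR// /om natrD.
  have : (0 <= d%:R :> R) by rewrite ler0n.
  move: (d%:R : R) => x x0; have : 0 <= x * x by rewrite mulr_ge0.
  by lra.
(* the additional e keeps the level positive when both norms vanish *)
pose kappa := K * (L `^ om * n2 + s) + e.
pose alpha := n2 ^+ 2 + e ^+ 2 / (K * T).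
have k0 : 0 < kappa.
  by rewrite /kappa ltr_wpDl// mulr_ge0 ?(ltW K0)// addr_ge0// mulr_ge0// ltW.
have sk : s <= kappa.
  have : 0 <= K * (L `^ om * n2).
    by apply: mulr_ge0; [exact: ltW|apply: mulr_ge0 => //; exact: ltW].
  have : s <= K * s by rewrite ler_peMl.
  by rewrite /kappa mulrDr; lra.
have al0 : 0 < alpha.
  by rewrite /alpha ltr_wpDl ?sqr_ge0// divr_gt0 ?exprn_gt0// mulr_gt0.
have uA : (\int[@lebesgue_tx R d]_(z in pcyl X0 rho) (pos_part u z ^+ 2)%:E <= alpha%:E)%E.
  rewrite (integral_sqr_Lnorm_on N2E) lee_fin lerDl.
  by rewrite divr_ge0 ?sqr_ge0// mulr_ge0 ?ltW.
have aeS := Lnorm_on_oo_ae t0 NsE.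
have hk : K * T * alpha <= kappa ^+ 2 by apply: level_bound => //; exact: ltW.
have aeu := @de_giorgi_iteration R d CpDG _ _ _ _ S u X0 r rho s kappa alpha
  d_ge1 CpDG_ge1 pdg mS PQ (introT andP (conj r0 rrho)) (introT andP (conj s0 sk))
  aeS al0 k0 uA hk.
have -> : (K%:E * ((L `^ om)%:E * n2%:E + s%:E) + e%:E = kappa%:E)%E by [].
apply: Lnorm_on_oo_le; first exact: ltW.
move: aeu; apply: filterS => z uz /uz {}uz.
by rewrite ger0_norm ?pos_part_ge0// /pos_part ge_max uz ltW.
Qed.
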